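(* Let $(M,g)$ be an arbitrary Riemannian manifold with Levi-Civita connection $\nabla$ and curvature tensor $\mathrm{R}$. For each $k\ge0$ there exists a quadratic expression $B(\nabla^{\le k-2}\mathrm{R})$ in the $(k-2)$-jet $\nabla^{\le k-2}\mathrm{R}=(\mathrm{R},\nabla\mathrm{R},\ldots,\nabla^{k-2}\mathrm{R})$ of the curvature tensor, with values in covariant $(k+4)$-tensors, such that $$\nabla^k\mathrm{R}+\frac{k+1}{k+3}\,\mathrm{KN}(\mathcal{R}^k)=B(\nabla^{\le k-2}\mathrm{R}),$$ where $\mathrm{KN}$ is the Kulkarni–Nomizu product in the variables $X_1,\dots,X_4$ tensored with the identity in the variables $X_5,\ldots,X_{k+4}$.
   Context: ''Riemannian manifold'' means a smooth manifold $M$ with a nondegenerate symmetric $(0,2)$-tensor field $g=\langle\cdot,\cdot\rangle$ (any signature). The curvature tensor is $\mathrm{R}(X,Y)Z=\nabla_X\nabla_YZ-\nabla_Y\nabla_XZ-\nabla_{[X,Y]}Z$, $\mathrm{R}_{X_1,X_2,X_3,X_4}=\langle\mathrm{R}(X_1,X_2)X_3,X_4\rangle$, and $\nabla^k\mathrm{R}$ is its $k$-fold iterated covariant derivative ($\nabla^{k+1}_{Y,X_1,\ldots,X_k}=\nabla_Y\nabla^k_{X_1,\ldots,X_k}-\sum_i\nabla^k_{X_1,\ldots,\nabla_YX_i,\ldots,X_k}$), regarded as the $(0,k+4)$-tensor $(X_1,\ldots,X_{k+4})\mapsto\nabla^k_{X_5,\ldots,X_{k+4}}\mathrm{R}_{X_1,X_2,X_3,X_4}$.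 The symmetrized $k$th covariant derivative of the curvature tensor is $\mathcal{R}^k(X)Y=\nabla^k_{X,\ldots,X}\mathrm{R}(Y,X)X$; it is viewed as the section of $\mathrm{Sym}^{k+2}T^*M\otimes\mathrm{Sym}^2T^*M$ characterized by $\mathcal{R}^k_{X,\ldots,X;\,Y,Z}=\langle\mathcal{R}^k(X)Y,Z\rangle$ (symmetric multilinear polarization in the first $k+2$ arguments). Explicitly, $$\begin{aligned}\mathrm{KN}(\mathcal{R}^k)_{X_1,\ldots,X_{k+4}}=\;&\mathcal{R}^k_{X_1,X_3,X_5,\ldots,X_{k+4};\,X_2,X_4}-\mathcal{R}^k_{X_2,X_3,X_5,\ldots,X_{k+4};\,X_1,X_4}\\&-\mathcal{R}^k_{X_1,X_4,X_5,\ldots,X_{k+4};\,X_2,X_3}+\mathcal{R}^k_{X_2,X_4,X_5,\ldots,X_{k+4};\,X_1,X_3}.\end{aligned}$$ ''Quadratic expression in the $(k-2)$-jet'' means a finite linear combination, with constant real coefficients, of covariant $(k+4)$-tensors obtained from tensor products $\nabla^a\mathrm{R}\otimes\nabla^b\mathrm{R}$ with $0\le a,b\le k-2$ by contraction with the metric and permutation of the arguments; for $k=0,1$ the jet is empty and the expression is $0$. *)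

(* Defs.v *)
From HB Require Import structures.
From mathcomp Require Import all_boot all_order all_algebra all_fingroup.
From mathcomp Require Import all_classical all_reals all_analysis.

Set Implicit Arguments.
Unset Strict Implicit.
Unset Printing Implicit Defensive.
Import Order.TTheory GRing.Theory Num.Theory.
Import numFieldNormedType.Exports.
Local Open Scope classical_set_scope.
Local Open Scope ring_scope.

Section Calculus.
Context {R : realType} {n : nat}.
Implicit Types (V : set 'rV[R]_n) (f : 'rV[R]_n -> R).

Definition pd (i : 'I_n) f : 'rV[R]_n -> R :=
  fun x => 'D_(delta_mx 0 i : 'rV[R]_n) f x.

(* On an open set V this is C^oo: all iterated partial derivatives exist and
   are continuous at the points of V. *)
Definition smooth_on V f : Prop :=
  forall (s : seq 'I_n) x, V x ->
    {for x, continuous (foldr pd f s)} /\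
    forall i : 'I_n, derivable (foldr pd f s) x (delta_mx 0 i : 'rV[R]_n).

End Calculus.

Section Manifold.
Context (R : realType) (n : nat).

Record chart (T : topologicalType) := Chart {
  cdom : set T;
  cmap : T -> 'rV[R]_n;
  cinv : 'rV[R]_n -> T;
  cdom_open : open cdom;
  cimg_open : open (cmap @` cdom);
  cmapK : forall p, cdom p -> cinv (cmap p) = p;
  cmap_continuous : {within cdom, continuous cmap};
  cinv_continuous : {within cmap @` cdom, continuous cinv} }.

Definition cimg T (a : chart T) : set 'rV[R]_n := cmap a @` cdom a.

Definition overlap T (a b : chart T) : set 'rV[R]_n :=
  cmap a @` (cdom a `&` cdom b).

Definition transition T (a b : chart T) (q : 'I_n) : 'rV[R]_n -> R :=
  fun x => cmap b (cinv a x) 0 q.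

Record manifold := Manifold {
  points :> topologicalType;
  points_hausdorff : hausdorff_space points;
  points_second_countable : @second_countable points;
  atlas : set (chart points);
  atlas_cover : forall p : points, exists2 a, atlas a & cdom a p;
  atlas_smooth : forall a b, atlas a -> atlas b ->
    forall q, smooth_on (overlap a b) (transition a b q) }.

Definition inner (G : 'M[R]_n) (u v : 'rV[R]_n) : R := (u *m G *m v^T) 0 0.

(* A nondegenerate symmetric (0,2)-tensor field, given by its components in the
   charts of the atlas. *)
Record metric (M : manifold) := Metric {
  gram :> chart M -> 'rV[R]_n -> 'M[R]_n;
  gram_smooth : forall a, atlas a ->
    forall i j, smooth_on (cimg a) (fun x => gram a x i j);
  gram_sym : forall a, atlas a ->
    forall x, cimg a x -> forall u v, inner (gram a x) u v = inner (gram a x) v u;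
  gram_nondeg : forall a, atlas a -> forall x, cimg a x ->
    forall u, (forall v, inner (gram a x) u v = 0) -> u = 0;
  gram_change : forall a b, atlas a -> atlas b -> forall x, overlap a b x ->
    forall i j, gram a x i j =
      \sum_(p < n) \sum_(q < n) gram b (cmap b (cinv a x)) p q
        * pd i (transition a b p) x * pd j (transition a b q) x }.

Definition christoffel := 'rV[R]_n -> 'I_n -> 'I_n -> 'I_n -> R.

(* An affine connection, given in each chart by the functions
   Gamma x l i j = Gamma^l_{ij}(x), where
   nabla_{d_i} d_j = \sum_l Gamma^l_{ij} d_l. *)
Record connection (M : manifold) := Connection {
  gamma :> chart M -> christoffel;
  gamma_smooth : forall a, atlas a ->
    forall l i j, smooth_on (cimg a) (fun x => gamma a x l i j);
  gamma_change : forall a b, atlas a -> atlas b -> forall x, overlap a b x ->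
    forall m i j,
      \sum_(l < n) gamma a x l i j * pd l (transition a b m) x =
      pd i (pd j (transition a b m)) x
      + \sum_(p < n) \sum_(q < n) gamma b (cmap b (cinv a x)) m p q
          * pd i (transition a b p) x * pd j (transition a b q) x }.

(* Vector fields on a chart domain, in the coordinates of the chart; only the
   values on the image of the chart are meaningful. *)
Definition vfield := 'rV[R]_n -> 'rV[R]_n.

Definition smooth_field (V : set 'rV[R]_n) (X : vfield) : Prop :=
  forall i, smooth_on V (fun x => X x 0 i).

Definition coord_field (i : 'I_n) : vfield := fun=> delta_mx 0 i.

Definition dir (X : vfield) (f : 'rV[R]_n -> R) : 'rV[R]_n -> R :=
  fun x => \sum_(i < n) X x 0 i * pd i f x.

Definition bracket (X Y : vfield) : vfield := fun x =>
  \row_l (dir X (fun y => Y y 0 l) x - dir Y (fun y => X y 0 l) x).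

Definition nabla (Ga : christoffel) (X Y : vfield) : vfield := fun x =>
  \row_l (dir X (fun y => Y y 0 l) x
          + \sum_(i < n) \sum_(j < n) Ga x l i j * X x 0 i * Y x 0 j).

Definition torsion_free (M : manifold) (D : connection M) : Prop :=
  forall a, atlas a -> forall X Y,
    smooth_field (cimg a) X -> smooth_field (cimg a) Y ->
    forall x, cimg a x ->
      nabla (D a) X Y x - nabla (D a) Y X x = bracket X Y x.

Definition metric_compatible (M : manifold) (g : metric M) (D : connection M) :=
  forall a, atlas a -> forall X Y Z,
    smooth_field (cimg a) X -> smooth_field (cimg a) Y ->
    smooth_field (cimg a) Z ->
    forall x, cimg a x ->
      dir Z (fun y => inner (g a y) (X y) (Y y)) x =
      inner (g a x) (nabla (D a) Z X x) (Y x)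
      + inner (g a x) (X x) (nabla (D a) Z Y x).

Definition levi_civita (M : manifold) (g : metric M) (D : connection M) : Prop :=
  torsion_free D /\ metric_compatible g D.

(* Covariant m-tensor fields on a chart domain, as functions of m vector
   fields. *)
Definition tensor (m : nat) := ('I_m -> vfield) -> 'rV[R]_n -> R.

Section Curvature.
Variables (G : 'rV[R]_n -> 'M[R]_n) (Ga : christoffel).

Definition curv (X Y Z : vfield) : vfield := fun x =>
  nabla Ga X (nabla Ga Y Z) x - nabla Ga Y (nabla Ga X Z) x
  - nabla Ga (bracket X Y) Z x.

Definition curv4 : tensor 4 := fun X x =>
  inner (G x) (curv (X (inord 0)) (X (inord 1)) (X (inord 2)) x)
        (X (inord 3) x).

Definition replace m (X : 'I_m -> vfield) (i : 'I_m) (Y : vfield) :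
  'I_m -> vfield := fun j => if j == i then Y else X j.

(* The slots 0, 1, 2, 3 are those of the curvature tensor, and the slots
   4, ..., k+3 are the directions of differentiation, the outermost derivative
   first.  Hence the newest direction Y sits in slot 4, and [lift (inord 4)]
   enumerates the remaining slots in order.  The sum over the first four slots
   is the covariant derivative of a (0,4)-tensor along Y, the rest of it is
   \sum_i nabla^k_{.., nabla_Y X_i, ..}. *)
Fixpoint nablaR (k : nat) : tensor k.+4 :=
  match k with
  | 0 => curv4
  | k'.+1 => fun X x =>
      let Y := X (inord 4) in
      let Z := fun i : 'I_k'.+4 => X (lift (inord 4) i) in
      dir Y (nablaR Z) x
      - \sum_(i < k'.+4) nablaR (replace Z i (nabla Ga Y (Z i))) x
  end.

(* The arguments (Y, X_0, X_1, Z, X_2, ..., X_{k+1}). *)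
Definition jacobi_args k (X : 'I_k.+2 -> vfield) (Y Z : vfield) :
  'I_k.+4 -> vfield := fun i =>
  match val i with
  | 0 => Y
  | 1 => X (inord 0)
  | 2 => X (inord 1)
  | 3 => Z
  | j => X (inord (j - 2))
  end.

(* < nabla^k_{X,..,X} R (Y, X) X, Z > *)
Definition jacobi k (X Y Z : vfield) : 'rV[R]_n -> R :=
  nablaR (@jacobi_args k (fun=> X) Y Z).

(* The polarization of [jacobi k], i.e. the form which is symmetric and
   multilinear in its first k+2 arguments and has [jacobi k] on the diagonal;
   see [symcurv_diag] and [symcurv_perm]. *)
Definition symcurv k (X : 'I_k.+2 -> vfield) (Y Z : vfield) : 'rV[R]_n -> R :=
  fun x => ((k.+2)`!%:R)^-1
    * \sum_(s : 'S_k.+2) nablaR (jacobi_args (fun i => X (s i)) Y Z) x.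

Lemma symcurv_diag k X Y Z x :
  @symcurv k (fun=> X) Y Z x = @jacobi k X Y Z x.
Proof.
rewrite /symcurv /jacobi sumr_const card_Sn.
by rewrite -[in X in _ * X]mulr_natl mulrA mulVf ?mul1r //.
Qed.

Lemma symcurv_perm k (X : 'I_k.+2 -> vfield) Y Z x (t : 'S_k.+2) :
  symcurv (fun i => X (t i)) Y Z x = symcurv X Y Z x.
Proof.
congr (_ * _); rewrite [RHS](reindex_inj (mulIg t)) /=.
apply: eq_bigr => s _; congr (nablaR (jacobi_args _ Y Z) x).
by apply/funext => i; rewrite permM.
Qed.

(* The arguments (A, B, X_5, ..., X_{k+4}) when X = (X_1, ..., X_{k+4}). *)
Definition kn_args k (A B : vfield) (X : 'I_k.+4 -> vfield) :
  'I_k.+2 -> vfield := fun i =>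
  match val i with
  | 0 => A
  | 1 => B
  | j => X (inord (j + 2))
  end.

Definition KN k (S : ('I_k.+2 -> vfield) -> vfield -> vfield -> 'rV[R]_n -> R) :
  tensor k.+4 := fun X x =>
  let X1 := X (inord 0) in let X2 := X (inord 1) in
  let X3 := X (inord 2) in let X4 := X (inord 3) in
    S (kn_args X1 X3 X) X2 X4 x - S (kn_args X2 X3 X) X1 X4 x
  - S (kn_args X1 X4 X) X2 X3 x + S (kn_args X2 X4 X) X1 X3 x.

End Curvature.

(* Covariant m-tensors obtained from products of nabla^a R and nabla^b R with
   a, b <= k - 2 (no such a, b exist if k < 2); [QContr] contracts the first two
   slots with the metric. *)
Inductive qmonomial (k : nat) : nat -> Type :=
| QProd a b of (a.+2 <= k)%N & (b.+2 <= k)%N : qmonomial k (a.+4 + b.+4)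
| QPerm m of 'S_m & qmonomial k m : qmonomial k m
| QContr m of qmonomial k m.+2 : qmonomial k m.

(* Finite linear combinations of such (k+4)-tensors with constant
   coefficients. *)
Definition qexpr (k : nat) := seq (R * qmonomial k k.+4).

Section Evaluation.
Variables (G : 'rV[R]_n -> 'M[R]_n) (Ga : christoffel).

Definition args_cons m (Y : vfield) (X : 'I_m -> vfield) : 'I_m.+1 -> vfield :=
  fun i => if unlift ord0 i is Some j then X j else Y.

Definition contract m (T : tensor m.+2) : tensor m := fun X x =>
  \sum_(i < n) \sum_(j < n) invmx (G x) i j
    * T (args_cons (coord_field i) (args_cons (coord_field j) X)) x.

Fixpoint qmonomial_eval k m (q : qmonomial k m) : tensor m :=
  match q with
  | QProd a b _ _ => fun X x =>
      nablaR G Ga (fun i : 'I_a.+4 => X (lshift b.+4 i)) x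
      * nablaR G Ga (fun i : 'I_b.+4 => X (rshift a.+4 i)) x
  | QPerm _ s q' => fun X => qmonomial_eval q' (fun i => X (s i))
  | QContr _ q' => contract (qmonomial_eval q')
  end.

Definition qexpr_eval k (B : qexpr k) : tensor k.+4 := fun X x =>
  \sum_(c <- B) c.1 * qmonomial_eval c.2 X x.

End Evaluation.
End Manifold.

(* Main.v *)
(* In nabla^k R the directions of differentiation commute modulo quadratic
   expressions: the Ricci identity does this for the outermost pair, and covariant
   differentiation maps quadratic expressions in the (k-2)-jet to quadratic
   expressions in the (k-1)-jet.  The algebraic symmetries and the two Bianchi
   identities hold exactly.  So modulo quadratic expressions nabla^k R is a function
   F(a, b, c, d) of the four distinct arguments in its curvature slots, among the
   k+4 given ones, with the symmetries of a curvature tensor and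
   F(a, b, c, d) + F(b, e, c, d) + F(e, a, c, d) = 0.  Writing
   S(y, z) = \sum_(p, q) F(y, p, q, z), both Bianchi identities give
   S(b, d) - S(a, d) = - (k+3) \sum_q F(a, b, q, d), and the second one also gives
   \sum_q (F(a, b, q, d) - F(a, b, q, c)) = (k+2) F(a, b, c, d).  Hence the
   Kulkarni-Nomizu combination of the S(y, z) is - (k+2)(k+3) F(a, b, c, d), while
   the polarized Jacobi operator is S(y, z) / ((k+1)(k+2)). *)
Require Import Defs.
From HB Require Import structures.
From mathcomp Require Import all_boot all_order all_algebra all_fingroup.
From mathcomp Require Import all_classical all_reals all_analysis.
From mathcomp Require Import ring lra zify.

Set Implicit Arguments.
Unset Strict Implicit.
Unset Printing Implicit Defensive.
Import Order.TTheory GRing.Theory Num.Theory.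
Import numFieldNormedType.Exports.
Local Open Scope classical_set_scope.
Local Open Scope ring_scope.

(** * Curvature calculus over a ring of functions *)

(** One expression has to serve all charts, so the relations modulo quadratic terms are proved for
    every [geometry] at once ([quad]). The linear combinations of nabla^k R with permuted arguments
    that are quadratic on the given manifold form a linear subspace of the functions on the
    symmetric group of k+4 letters. Instead of computing in the quotient, [duality] tests the
    left-hand side against an arbitrary functional [phi] that annihilates this subspace. For [phi]
    all relations, also the commutation of derivatives, are exact equations between real numbers,
    and the F of the overview is [word phi]. The arguments are permutations of the given ones, so F
    comes only from distinct letters. Setting it to 0 elsewhere lets the sums range over all
    letters; the price is that the second Bianchi identity holds for five distinct letters only and
    that exceptional terms appear. The generic terms alone would give the factor k+2 in S(b, d) -
    S(a, d); the exceptional ones raise it to k+3. *)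

(* The data that a torsion-free metric connection induces on the fields [vf]
   over the ring [fn] of functions on a chart: [cov X Y - cov Y X] plays the role
   of the Lie bracket. *)
Record geometry (n : nat) := Geometry {
  fn : comPzRingType;
  vf : lmodType fn;
  der : vf -> fn -> fn;
  cov : vf -> vf -> vf;
  ip : vf -> vf -> fn;
  frame : 'I_n -> vf;
  cometric : 'I_n -> 'I_n -> fn;
  derD : forall X f h, der X (f + h) = der X f + der X h;
  derM : forall X f h, der X (f * h) = der X f * h + f * der X h;
  der_linear : forall f X Y h, der (f *: X + Y) h = f * der X h + der Y h;
  cov_linear : forall f X Y Z, cov (f *: X + Y) Z = f *: cov X Z + cov Y Z;
  covD : forall X Y Z, cov X (Y + Z) = cov X Y + cov X Z;
  covM : forall X f Y, cov X (f *: Y) = der X f *: Y + f *: cov X Y;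
  der_comm : forall X Y f,
    der (cov X Y - cov Y X) f = der X (der Y f) - der Y (der X f);
  jacobi_identity : let br X Y := cov X Y - cov Y X in
    forall X Y Z, br X (br Y Z) + br Y (br Z X) + br Z (br X Y) = 0;
  ip_linear : forall f X Y Z, ip (f *: X + Y) Z = f * ip X Z + ip Y Z;
  ipC : forall X Y, ip X Y = ip Y X;
  ip_compat : forall X Y Z, der Z (ip X Y) = ip (cov Z X) Y + ip X (cov Z Y);
  cometricC : forall i j, cometric i j = cometric j i;
  ip_coframe : forall i j,
    ip (\sum_k cometric i k *: frame k) (frame j) = (i == j)%:R;
  coframe_expand : forall X,
    X = \sum_i ip X (frame i) *: \sum_j cometric i j *: frame j }.

Section Tensors.
Variables (n : nat) (g : geometry n).
Local Notation A := (fn g).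
Local Notation E := (vf g).
Implicit Types (f h : A) (X Y Z W U : E).

Lemma der0 X : der X 0 = 0.
Proof. by have /eqP := derD X 0 0; rewrite addr0 -subr_eq0 opprD addNKr oppr_eq0 => /eqP. Qed.

Lemma derN X f : der X (- f) = - der X f.
Proof. by apply/eqP; rewrite -addr_eq0 -derD addNr der0. Qed.

Lemma derB X f h : der X (f - h) = der X f - der X h.
Proof. by rewrite derD derN. Qed.

Lemma der_sum X (I : Type) (r : seq I) (P : pred I) (F : I -> A) :
  der X (\sum_(i <- r | P i) F i) = \sum_(i <- r | P i) der X (F i).
Proof. by apply: (big_morph (der X)) => [a b|]; [exact: derD | exact: der0]. Qed.

Lemma der1 X : der X 1 = 0.
Proof.
have /eqP := derM X 1 1; rewrite !mul1r mulr1 -subr_eq0 opprD addNKr oppr_eq0.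
by move/eqP.
Qed.

Lemma der_bool X (b : bool) : der X b%:R = 0.
Proof. by case: b; rewrite ?der1 ?der0. Qed.

Lemma cov0 X : cov X 0 = 0.
Proof. by have /eqP := covD X 0 0; rewrite addr0 -subr_eq0 opprD addNKr oppr_eq0 => /eqP. Qed.

Lemma covN X Y : cov X (- Y) = - cov X Y.
Proof. by apply/eqP; rewrite -addr_eq0 -covD addNr cov0. Qed.

Lemma cov_sum X (I : Type) (r : seq I) (P : pred I) (F : I -> E) :
  cov X (\sum_(i <- r | P i) F i) = \sum_(i <- r | P i) cov X (F i).
Proof. by apply: (big_morph (cov X)) => [a b|]; [exact: covD | exact: cov0]. Qed.

Lemma cov_addl X Y Z : cov (X + Y) Z = cov X Z + cov Y Z.
Proof. by rewrite -{1}[X]scale1r cov_linear scale1r. Qed.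

Lemma cov_subl X Y Z : cov (X - Y) Z = cov X Z - cov Y Z.
Proof. by rewrite addrC -scaleN1r cov_linear scaleN1r addrC. Qed.

Lemma cov0l Z : cov 0 Z = 0.
Proof. by have := cov_subl 0 0 Z; rewrite !subrr. Qed.

Lemma covNl X Z : cov (- X) Z = - cov X Z.
Proof. by rewrite -sub0r cov_subl cov0l sub0r. Qed.

Lemma covZl f X Z : cov (f *: X) Z = f *: cov X Z.
Proof. by rewrite -[f *: X]addr0 cov_linear cov0l addr0. Qed.

Lemma der_subl X Y f : der (X - Y) f = der X f - der Y f.
Proof. by rewrite addrC -scaleN1r der_linear mulN1r addrC. Qed.

Lemma ip0l X : ip 0 X = 0.
Proof.
have := ip_linear 1 0 0 X; rewrite scale1r addr0 mul1r => /eqP.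
by rewrite -subr_eq0 opprD addNKr oppr_eq0 => /eqP.
Qed.

Lemma ipDl X Y Z : ip (X + Y) Z = ip X Z + ip Y Z.
Proof. by rewrite -{1}[X]scale1r ip_linear mul1r. Qed.

Lemma ipZl f X Z : ip (f *: X) Z = f * ip X Z.
Proof. by rewrite -[f *: X]addr0 ip_linear ip0l addr0. Qed.

Lemma ipNl X Z : ip (- X) Z = - ip X Z.
Proof. by rewrite -scaleN1r ipZl mulN1r. Qed.

Lemma ip_suml (I : Type) (r : seq I) (P : pred I) (F : I -> E) Z :
  ip (\sum_(i <- r | P i) F i) Z = \sum_(i <- r | P i) ip (F i) Z.
Proof. exact: (big_morph (fun Y => ip Y Z) (fun a b => ipDl a b Z) (ip0l Z)). Qed.

Lemma ipDr X Y Z : ip Z (X + Y) = ip Z X + ip Z Y.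
Proof. by rewrite ipC ipDl !(ipC Z). Qed.

Lemma ipZr f X Z : ip Z (f *: X) = f * ip Z X.
Proof. by rewrite ipC ipZl (ipC Z). Qed.

Lemma ip_sumr (I : Type) (r : seq I) (P : pred I) (F : I -> E) Z :
  ip Z (\sum_(i <- r | P i) F i) = \sum_(i <- r | P i) ip Z (F i).
Proof. by rewrite ipC ip_suml; apply: eq_bigr => i _; rewrite ipC. Qed.

Definition coframe i : E := \sum_j cometric g i j *: frame g j.

Lemma frame_expand X : X = \sum_i ip X (coframe i) *: frame g i.
Proof.
rewrite {1}[X]coframe_expand.
under eq_bigr do rewrite scaler_sumr.
rewrite exchange_big; apply: eq_bigr => i _ /=.
rewrite ip_sumr scaler_suml; apply: eq_bigr => j _.
by rewrite ipZr scalerA mulrC cometricC.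
Qed.

Definition curvop X Y Z : E :=
  cov X (cov Y Z) - cov Y (cov X Z) - cov (cov X Y - cov Y X) Z.

End Tensors.

Definition repl (I : eqType) (T : Type) (X : I -> T) (i : I) (Y : T) : I -> T :=
  fun j => if j == i then Y else X j.

(** [option I] is the slot set [I] enlarged by one slot [None], which takes the direction of a new
    derivative or an argument about to be contracted. *)
Definition ocons (I T : Type) (Y : T) (X : I -> T) : option I -> T :=
  fun o => if o is Some i then X i else Y.

Section Substitution.
Variables (I : eqType) (T : Type).
Implicit Types (X : I -> T) (Y Z : T).

Lemma repl_eq X i Y : repl X i Y i = Y.
Proof. by rewrite /repl eqxx. Qed.

Lemma repl_neq X i j Y : j != i -> repl X i Y j = X j.
Proof. by rewrite /repl => /negPf ->. Qed.

Lemma repl_repl X i Y Z : repl (repl X i Y) i Z = repl X i Z.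
Proof. by apply/funext => j; rewrite /repl; case: eqP. Qed.

Lemma repl_comm X i j Y Z : i != j ->
  repl (repl X i Y) j Z = repl (repl X j Z) i Y.
Proof.
move=> ij; apply/funext => l; rewrite /repl.
by case: eqP => // ->; rewrite eq_sym (negPf ij).
Qed.

Lemma repl_comp (J : eqType) (h : J -> I) X j Y : injective h ->
  repl X (h j) Y \o h = repl (X \o h) j Y.
Proof. by move=> hI; apply/funext => l; rewrite /repl /= (inj_eq hI). Qed.

Lemma repl_ocons_Some X Y i Z :
  repl (ocons Y X) (Some i) Z = ocons Y (repl X i Z).
Proof. by apply/funext => -[j|]. Qed.

Lemma repl_ocons_None X Y Z : repl (ocons Y X) None Z = ocons Z X.
Proof. by apply/funext => -[j|]. Qed.

Lemma ocons_eta (X : option I -> T) : X = ocons (X None) (X \o Some).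
Proof. by apply/funext => -[j|]. Qed.

End Substitution.

Lemma big_option (V : nmodType) (I : finType) (F : option I -> V) :
  \sum_o F o = F None + \sum_i F (Some i).
Proof.
rewrite (bigD1 None) //=; congr (_ + _).
rewrite (reindex_omap Some id) /=; last by case.
by apply: eq_bigl => i; rewrite eqxx.
Qed.

Definition tens (n : nat) (g : geometry n) (I : Type) := (I -> vf g) -> fn g.

(** * Covariant derivatives, products and contractions of tensors; the Ricci identity *)

Section CovariantDerivative.
Variables (n : nat) (g : geometry n).
Local Notation A := (fn g).
Local Notation E := (vf g).

Definition multilin (I : eqType) (T : tens g I) : Prop :=
  forall X i f Y Z,
    T (repl X i (f *: Y + Z)) = f * T (repl X i Y) + T (repl X i Z).

Section Multilinear.
Variables (I : eqType) (T : tens g I).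
Hypothesis Tlin : multilin T.

Lemma multilinD X i Y Z : T (repl X i (Y + Z)) = T (repl X i Y) + T (repl X i Z).
Proof. by rewrite -{1}[Y]scale1r Tlin mul1r. Qed.

Lemma multilin0 X i : T (repl X i 0) = 0.
Proof.
have /eqP := multilinD X i 0 0; rewrite addr0 -subr_eq0 opprD addNKr oppr_eq0.
by move/eqP.
Qed.

Lemma multilinZ X i f Y : T (repl X i (f *: Y)) = f * T (repl X i Y).
Proof. by rewrite -[f *: Y]addr0 Tlin multilin0 addr0. Qed.

Lemma multilinB X i Y Z : T (repl X i (Y - Z)) = T (repl X i Y) - T (repl X i Z).
Proof. by rewrite multilinD -scaleN1r multilinZ mulN1r. Qed.

Lemma multilin_sum X i (J : Type) (r : seq J) (P : pred J) (F : J -> E) :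
  T (repl X i (\sum_(j <- r | P j) F j)) = \sum_(j <- r | P j) T (repl X i (F j)).
Proof.
exact: (big_morph (fun Y => T (repl X i Y)) (multilinD X i) (multilin0 X i)).
Qed.

End Multilinear.

Definition cder (I : finType) (T : tens g I) : tens g (option I) := fun X =>
  der (X None) (T (X \o Some))
  - \sum_i T (repl (X \o Some) i (cov (X None) (X (Some i)))).

Lemma cderE (I : finType) (T : tens g I) Y X : cder T (ocons Y X) =
  der Y (T X) - \sum_i T (repl X i (cov Y (X i))).
Proof. by []. Qed.

(** In an old slot, the term with [der Y f] from the product rule cancels the one that [covM]
    produces in the same slot; in the direction slot, [der] and [cov] are linear over functions. *)
Lemma cder_multilin (I : finType) (T : tens g I) :
  multilin T -> multilin (cder T).
Proof.
move=> Tlin X [i|] f U V; rewrite [X]ocons_eta; last first.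
  rewrite !repl_ocons_None !cderE der_linear.
  under eq_bigr do rewrite cov_linear Tlin.
  by rewrite big_split /= -mulr_sumr; ring.
move: (X None) (X \o Some) => Y {}X.
rewrite !repl_ocons_Some !cderE Tlin derD derM.
rewrite !(bigD1 (P := predT) i) //= !repl_eq !repl_repl covD covM.
rewrite (multilinD Tlin) Tlin (multilinZ Tlin).
have others W :
    \sum_(j | j != i) T (repl (repl X i W) j (cov Y (repl X i W j)))
  = \sum_(j | j != i) T (repl (repl X j (cov Y (X j))) i W).
  by apply: eq_bigr => j ji; rewrite repl_neq // repl_comm // eq_sym.
rewrite !others.
under eq_bigr do rewrite Tlin.
by rewrite big_split /= -mulr_sumr; ring.
Qed.

Section Ricci.
Variables (I : finType) (T : tens g I).
Hypothesis Tlin : multilin T.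
Implicit Types (X : I -> E) (Y Z : E).

(** The part of the second derivative in which the two directions hit different slots. It is
    symmetric in the directions and drops out of the commutator. *)
Let mixed Y Z X := \sum_i \sum_(j | j != i)
  T (repl (repl X i (cov Y (X i))) j (cov Z (X j))).

Let mixedC Y Z X : mixed Y Z X = mixed Z Y X.
Proof.
rewrite /mixed (exchange_big_dep predT) //=; apply: eq_bigr => i _.
under eq_bigl do rewrite eq_sym.
by apply: eq_bigr => j ji; rewrite repl_comm.
Qed.

Let cder2 Y Z X : cder (cder T) (ocons Y (ocons Z X)) =
  der Y (der Z (T X)) - der (cov Y Z) (T X)
  - \sum_i der Y (T (repl X i (cov Z (X i))))
  - \sum_i der Z (T (repl X i (cov Y (X i))))
  + \sum_i T (repl X i (cov (cov Y Z) (X i)))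
  + \sum_i T (repl X i (cov Z (cov Y (X i)))) + mixed Y Z X.
Proof.
rewrite !cderE big_option repl_ocons_None cderE derB der_sum.
have -> : \sum_i cder T (repl (ocons Z X) (Some i) (cov Y (ocons Z X (Some i))))
  = \sum_i (der Z (T (repl X i (cov Y (X i))))
      - (T (repl X i (cov Z (cov Y (X i)))) + \sum_(j | j != i)
           T (repl (repl X i (cov Y (X i))) j (cov Z (X j))))).
  apply: eq_bigr => i _; rewrite repl_ocons_Some cderE (bigD1 i) //=.
  rewrite repl_repl repl_eq; congr (_ - (_ + _)).
  by apply: eq_bigr => j ji; rewrite repl_neq.
by rewrite sumrB big_split /= -/(mixed Y Z X); ring.
Qed.

(** After the symmetric terms cancel, [der_comm] removes the derivatives of the function [T X], and
    what remains in each slot is exactly [curvop]. *)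
Lemma ricci_identity Y Z X :
  cder (cder T) (ocons Y (ocons Z X)) - cder (cder T) (ocons Z (ocons Y X))
  = - \sum_i T (repl X i (curvop Y Z (X i))).
Proof.
rewrite !cder2 (mixedC Z Y).
under [in RHS]eq_bigr do rewrite /curvop cov_subl !(multilinB Tlin).
rewrite !sumrB; have := der_comm Y Z (T X); rewrite der_subl => dc.
have -> : der Y (der Z (T X)) = der Z (der Y (T X))
    + (der (cov Y Z) (T X) - der (cov Z Y) (T X)) by rewrite dc; ring.
by ring.
Qed.

End Ricci.

Lemma cder_ext (I : finType) (T T' : tens g I) :
  T =1 T' -> cder T =1 cder T'.
Proof. by move=> TT' X; rewrite /cder TT'; under eq_bigr do rewrite TT'. Qed.

Lemma cderD (I : finType) (T T' : tens g I) X :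
  cder (fun X => T X + T' X) X = cder T X + cder T' X.
Proof. by rewrite /cder derD big_split /=; ring. Qed.

Lemma cderN (I : finType) (T : tens g I) X :
  cder (fun X => - T X) X = - cder T X.
Proof. by rewrite /cder derN sumrN; ring. Qed.

Lemma cder_bij (I J : finType) (h : I -> J) (T : tens g I) X : bijective h ->
  cder (fun X => T (X \o h)) X = cder T (X \o omap h).
Proof.
move=> hB; rewrite /cder /=; congr (_ - _).
rewrite (reindex h) /=; last exact: onW_bij.
by apply: eq_bigr => i _; rewrite repl_comp //; exact: bij_inj.
Qed.

Definition tprod (I J : finType) (T : tens g I) (S : tens g J) :
  tens g (I + J)%type := fun X => T (X \o inl) * S (X \o inr).

Lemma cder_tprod (I J : finType) (T : tens g I) (S : tens g J) X :
  cder (tprod T S) X =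
  cder T (X \o omap inl) * S (X \o (Some \o inr))
  + T (X \o (Some \o inl)) * cder S (X \o omap inr).
Proof.
rewrite /cder /tprod derM big_sumType /=.
have replL i Y : repl (X \o Some) (inl i) Y \o inl = repl (X \o (Some \o @inl I J)) i Y.
  by apply/funext => j.
have replL' i Y : repl (X \o Some) (inl i) Y \o inr = X \o (Some \o @inr I J).
  by apply/funext => j.
have replR i Y : repl (X \o Some) (inr i) Y \o inr = repl (X \o (Some \o @inr I J)) i Y.
  by apply/funext => j.
have replR' i Y : repl (X \o Some) (inr i) Y \o inl = X \o (Some \o @inl I J).
  by apply/funext => j.
under [X in _ - (X + _)]eq_bigr do rewrite replL replL'.
under [X in _ - (_ + X)]eq_bigr do rewrite replR replR'.
by rewrite -mulr_suml -mulr_sumr; ring.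
Qed.

Lemma tprod_multilin (I J : finType) (T : tens g I) (S : tens g J) :
  multilin T -> multilin S -> multilin (tprod T S).
Proof.
move=> Tl Sl X [i|i] f Y Z; rewrite /tprod.
  have E1 W : repl X (inl i) W \o inl = repl (X \o @inl I J) i W by apply/funext.
  have E2 W : repl X (inl i) W \o inr = X \o @inr I J by apply/funext.
  by rewrite !E1 !E2 Tl; ring.
have E1 W : repl X (inr i) W \o inr = repl (X \o @inr I J) i W by apply/funext.
have E2 W : repl X (inr i) W \o inl = X \o @inl I J by apply/funext.
by rewrite !E1 !E2 Sl; ring.
Qed.

Definition tcontr (I : finType) (T : tens g (option (option I))) : tens g I :=
  fun X => \sum_i \sum_j
    cometric g i j * T (ocons (frame g i) (ocons (frame g j) X)).

Lemma tcontr_multilin (I : finType) (T : tens g (option (option I))) :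
  multilin T -> multilin (tcontr T).
Proof.
move=> Tl X i f Y Z; rewrite /tcontr mulr_sumr -big_split /=.
apply: eq_bigr => k _; rewrite mulr_sumr -big_split /=; apply: eq_bigr => l _.
by rewrite -!repl_ocons_Some Tl; ring.
Qed.

(* The metric is parallel, so differentiating its inverse cancels the
   derivatives of the frame. *)
Lemma cometric_parallel (b : E -> E -> A) Y :
  (forall f U V W, b (f *: U + V) W = f * b U W + b V W) ->
  (forall f U V W, b W (f *: U + V) = f * b W U + b W V) ->
  \sum_i \sum_j der Y (cometric g i j) * b (frame g i) (frame g j)
  = - \sum_i \sum_j cometric g i j *
      (b (cov Y (frame g i)) (frame g j) + b (frame g i) (cov Y (frame g j))).
Proof.
move=> bl br.
have b0l W : b 0 W = 0.
  have /eqP := bl 1 0 0 W; rewrite scale1r addr0 mul1r -subr_eq0 opprD addNKr.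
  by rewrite oppr_eq0 => /eqP.
have b0r W : b W 0 = 0.
  have /eqP := br 1 0 0 W; rewrite scale1r addr0 mul1r -subr_eq0 opprD addNKr.
  by rewrite oppr_eq0 => /eqP.
have bDl U V W : b (U + V) W = b U W + b V W by rewrite -{1}[U]scale1r bl mul1r.
have bDr U V W : b W (U + V) = b W U + b W V by rewrite -{1}[U]scale1r br mul1r.
have bZl f U W : b (f *: U) W = f * b U W by rewrite -[f *: U]addr0 bl b0l addr0.
have bZr f U W : b W (f *: U) = f * b W U by rewrite -[f *: U]addr0 br b0r addr0.
have bsl (F : 'I_n -> E) W : b (\sum_i F i) W = \sum_i b (F i) W.
  exact: (big_morph (fun V => b V W) (fun U V => bDl U V W) (b0l W)).
have bsr (F : 'I_n -> E) W : b W (\sum_i F i) = \sum_i b W (F i).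
  exact: (big_morph (fun V => b W V) (fun U V => bDr U V W) (b0r W)).
have cobasis i : b (frame g i) (cov Y (coframe g i)) =
  \sum_j (der Y (cometric g i j) * b (frame g i) (frame g j)
          + cometric g i j * b (frame g i) (cov Y (frame g j))).
  rewrite cov_sum bsr; apply: eq_bigr => j _.
  by rewrite covM bDr !bZr.
(* Expanded in the frame and in the dual frame, the two sides have opposite coefficients, because
   [ip (coframe g i) (frame g j)] is constant and the metric is compatible. *)
have cancel : \sum_i b (cov Y (frame g i)) (coframe g i) =
    - \sum_i b (frame g i) (cov Y (coframe g i)).
  have expandl i : b (cov Y (frame g i)) (coframe g i) =
      \sum_j ip (cov Y (frame g i)) (coframe g j) * b (frame g j) (coframe g i).
    rewrite {1}[cov Y (frame g i)]frame_expand bsl.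
    by apply: eq_bigr => j _; rewrite bZl.
  have expandr i : b (frame g i) (cov Y (coframe g i)) =
      \sum_j ip (cov Y (coframe g i)) (frame g j) * b (frame g i) (coframe g j).
    rewrite {1}[cov Y (coframe g i)]coframe_expand bsr.
    by apply: eq_bigr => j _; rewrite bZr.
  rewrite (eq_bigr _ (fun i _ => expandl i)) (eq_bigr _ (fun i _ => expandr i)).
  rewrite exchange_big /= -sumrN; apply: eq_bigr => i _.
  rewrite -sumrN; apply: eq_bigr => j _; rewrite -mulNr; congr (_ * _).
  have := ip_compat (coframe g i) (frame g j) Y; rewrite ip_coframe der_bool.
  by move=> /eqP; rewrite eq_sym addr_eq0 (ipC (coframe g i)) => /eqP ->; rewrite opprK.
apply/eqP; rewrite -addr_eq0 -big_split /=.
under eq_bigr => i _.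
  rewrite -big_split /=.
  under eq_bigr => j _ do
    rewrite mulrDr addrCA.
  rewrite big_split /= -cobasis.
  under eq_bigr => j _ do rewrite -bZr.
  rewrite -bsr.
  over.
by rewrite big_split /= cancel addNr.
Qed.

(** [cder T] has its direction in the outermost slot, whereas [tcontr] contracts the two outermost
    slots; this moves the direction behind the pair to be contracted. *)
Definition rot_opt (I : Type) (o : option (option (option I))) :
    option (option (option I)) :=
  match o with
  | None => Some (Some None)
  | Some None => None
  | Some (Some None) => Some None
  | _ => o
  end.

(** Both sides share the terms that differentiate [T] with the frame held fixed. The rest is the
    derivative of the inverse metric on one side and of the frame on the other, matched by
    [cometric_parallel]. *)
Lemma cder_tcontr (I : finType) (T : tens g (option (option I))) X :
  multilin T ->
  cder (tcontr T) X = tcontr (fun X => cder T (X \o @rot_opt I)) X.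
Proof.
move=> Tlin; rewrite [X]ocons_eta; move: (X None) (X \o Some) => Y {}X.
have rotE U V : ocons U (ocons V (ocons Y X)) \o @rot_opt I =
    ocons Y (ocons U (ocons V X)) by apply/funext => -[[[i|]|]|].
pose b U V := T (ocons U (ocons V X)).
pose c i j := \sum_l
  T (ocons (frame g i) (ocons (frame g j) (repl X l (cov Y (X l))))).
have -> : tcontr (fun X => cder T (X \o @rot_opt I)) (ocons Y X) =
    \sum_i \sum_j cometric g i j * (der Y (b (frame g i) (frame g j)) - c i j)
    - \sum_i \sum_j cometric g i j * (b (cov Y (frame g i)) (frame g j)
         + b (frame g i) (cov Y (frame g j))).
  rewrite -sumrB; apply: eq_bigr => i _; rewrite -sumrB; apply: eq_bigr => j _.
  rewrite rotE cderE 2!big_option /= repl_ocons_None repl_ocons_Some.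
  rewrite repl_ocons_None -mulrBr /b /c; congr (_ * _).
  under eq_bigr do rewrite !repl_ocons_Some.
  by ring.
have -> : cder (tcontr T) (ocons Y X) =
    \sum_i \sum_j cometric g i j * (der Y (b (frame g i) (frame g j)) - c i j)
    + \sum_i \sum_j der Y (cometric g i j) * b (frame g i) (frame g j).
  rewrite cderE /tcontr der_sum [X in _ - X]exchange_big /= -sumrB -big_split /=.
  apply: eq_bigr => i _; rewrite der_sum [X in _ - X]exchange_big /= -sumrB.
  rewrite -big_split /=; apply: eq_bigr => j _.
  by rewrite derM /b /c mulrBr mulr_sumr; ring.
congr (_ + _); apply: cometric_parallel => f U V W; rewrite /b.
  have reW Z : ocons Z (ocons W X) = repl (ocons 0 (ocons W X)) None Z.
    by rewrite repl_ocons_None.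
  by rewrite (reW U) (reW V) reW Tlin.
have reW Z : ocons W (ocons Z X) = repl (ocons W (ocons 0 X)) (Some None) Z.
  by rewrite repl_ocons_Some repl_ocons_None.
by rewrite (reW U) (reW V) reW Tlin.
Qed.

End CovariantDerivative.

(** * Algebraic symmetries and Bianchi identities of the curvature tensor *)

Section CurvatureTensor.
Variables (n : nat) (g : geometry n).
Local Notation A := (fn g).
Local Notation E := (vf g).
Implicit Types (f h : A) (X Y Z W U V : E).

(** Pairing with a field turns identities between fields into identities in a commutative ring,
    where [ring] applies. *)
Lemma ip_curvop X Y Z W : ip (curvop X Y Z) W =
  ip (cov X (cov Y Z)) W - ip (cov Y (cov X Z)) W
  - ip (cov (cov X Y) Z) W + ip (cov (cov Y X) Z) W.
Proof. by rewrite /curvop cov_subl !(ipDl, ipNl); ring. Qed.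

Lemma curvop_linear1 f X Y Z W V :
  ip (curvop (f *: X + Y) Z W) V = f * ip (curvop X Z W) V + ip (curvop Y Z W) V.
Proof.
rewrite !ip_curvop !(cov_addl, covZl, covD, covM).
by rewrite !(ipDl, ipZl); ring.
Qed.

Lemma curvop_anti12 X Y Z W : ip (curvop Y X Z) W = - ip (curvop X Y Z) W.
Proof. by rewrite !ip_curvop; ring. Qed.

Lemma curvop_linear2 f X Y Z W V :
  ip (curvop Z (f *: X + Y) W) V = f * ip (curvop Z X W) V + ip (curvop Z Y W) V.
Proof.
by rewrite curvop_anti12 curvop_linear1 !(curvop_anti12 Z); ring.
Qed.

Lemma curvop_linear3 f X Y Z W V :
  ip (curvop Z W (f *: X + Y)) V = f * ip (curvop Z W X) V + ip (curvop Z W Y) V.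
Proof.
rewrite !ip_curvop !(covD, covM, cov_addl) !(ipDl, ipZl).
have := der_comm Z W f; rewrite der_subl => dc.
have -> : der Z (der W f) = der W (der Z f) + (der (cov Z W) f - der (cov W Z) f).
  by rewrite dc; ring.
by ring.
Qed.

(** The commutator rule [der_comm] is applied to the function [ip Z W] and expanded by metric
    compatibility: the curvature operator is skew because it must kill this function. *)
Lemma curvop_anti34 X Y Z W : ip (curvop X Y W) Z = - ip (curvop X Y Z) W.
Proof.
have := der_comm X Y (ip Z W); rewrite der_subl !ip_compat !derD !ip_compat => dc.
apply/eqP; rewrite -addr_eq0 !ip_curvop; move/eqP: dc.
rewrite -subr_eq0 (ipC Z (cov (cov X Y) W)) (ipC Z (cov (cov Y X) W)).
rewrite (ipC Z (cov X (cov Y W))) (ipC Z (cov Y (cov X W))).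
rewrite (ipC (cov X Z)) (ipC (cov Y Z)) -oppr_eq0 => /eqP dc.
by apply/eqP; rewrite -[RHS]dc; ring.
Qed.

(** With [cov X Y - cov Y X] as bracket, the cyclic sum is the Jacobi identity of that bracket
    paired with [W]. *)
Lemma bianchi1 X Y Z W :
  ip (curvop X Y Z) W + ip (curvop Y Z X) W + ip (curvop Z X Y) W = 0.
Proof.
rewrite !ip_curvop; have /(congr1 (fun U => ip U W)) := jacobi_identity X Y Z.
rewrite !(covD, covN, cov_subl) !(ipDl, ipNl, ip0l) => jac.
by rewrite -[RHS]jac; ring.
Qed.

(** [D X Y Z] is the derivative of the curvature along [X], up to the slot of [W]. The triple
    compositions of [cov] cancel cyclically; what is left is [cov] along the Jacobi expression,
    which vanishes. *)
Lemma bianchi2 X Y Z U W :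
  let D X Y Z := ip (cov X (curvop Y Z U)) W - ip (curvop (cov X Y) Z U) W
     - ip (curvop Y (cov X Z) U) W - ip (curvop Y Z (cov X U)) W in
  D X Y Z + D Y Z X + D Z X Y = 0.
Proof.
rewrite /=.
rewrite !ip_curvop /curvop !(covD, covN, cov_subl, cov_addl) !(ipDl, ipNl).
have /(congr1 (fun V => ip (cov V U) W)) := jacobi_identity X Y Z.
rewrite !(covD, covN, covNl, cov_addl, cov0l) !(ipDl, ipNl, ip0l) => jac.
by rewrite -[RHS]oppr0 -[X in _ = - X]jac; ring.
Qed.

End CurvatureTensor.

(** * Iterated derivatives of the curvature and their exact symmetries *)

Section Nabla.
Variables (n : nat) (g : geometry n).
Local Notation E := (vf g).

Definition riem : tens g 'I_4 := fun X =>
  ip (curvop (X (inord 0)) (X (inord 1)) (X (inord 2))) (X (inord 3)).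

(** Puts the newest direction in slot 4, directly behind the curvature slots, in agreement with
    [nablaR]. *)
Definition newdir k (o : option 'I_k.+4) : 'I_k.+4.+1 :=
  if o is Some i then lift (inord 4) i else inord 4.

Fixpoint nab k : tens g 'I_k.+4 :=
  if k is j.+1 then fun X => cder (@nab j) (X \o @newdir j) else riem.
Arguments nab : clear implicits.

Lemma repl_inord m (X : 'I_m.+1 -> E) a b Y : (a <= m)%N -> (b <= m)%N ->
  repl X (inord a) Y (inord b) = if b == a then Y else X (inord b).
Proof. by move=> am bm; rewrite /repl -val_eqE /= !inordK. Qed.

Lemma inord_val4 (P : 'I_4 -> Prop) :
  P (inord 0) -> P (inord 1) -> P (inord 2) -> P (inord 3) -> forall i, P i.
Proof.
move=> P0 P1 P2 P3 i; rewrite -(inord_val i).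
by case: i => -[|[|[|[|//]]]].
Qed.

Lemma riem_multilin : multilin riem.
Proof.
move=> X i f Y Z; rewrite /riem; elim/inord_val4: i; rewrite !repl_inord //=.
- exact: curvop_linear1.
- exact: curvop_linear2.
- exact: curvop_linear3.
- by rewrite ipDr ipZr.
Qed.

Lemma newdirK k : cancel (@newdir k) (unlift (inord 4)).
Proof. by case=> [i|]; rewrite /newdir ?liftK ?unlift_none. Qed.

Lemma unlift4K k : cancel (unlift (inord 4)) (@newdir k).
Proof. by move=> i; case: unliftP => [j|] ->. Qed.

Lemma newdir_bij k : bijective (@newdir k).
Proof. exact: Bijective (@newdirK k) (@unlift4K k). Qed.

Lemma multilin_bij (I J : finType) (h : I -> J) (T : tens g I) :
  bijective h -> multilin T -> multilin (fun X => T (X \o h)).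
Proof.
move=> hB Tl X j f Y Z; have [h' _ h'K] := hB.
by rewrite -[j]h'K !(repl_comp _ _ _ (bij_inj hB)) Tl.
Qed.

Lemma nab_multilin k : multilin (nab k).
Proof.
elim: k => [|k IHk] /=; first exact: riem_multilin.
exact/multilin_bij/cder_multilin/IHk/newdir_bij.
Qed.

Definition anti (I : finType) (T : tens g I) (a b : I) :=
  forall X, T (X \o tperm a b) = - T X.

(** The two 3-cycles are written as products of transpositions, so that transport through [cder] and
    through bijections only has to be known for transpositions. *)
Definition cyc3 (I : finType) (T : tens g I) (a b c : I) := forall X,
  T X + T (X \o tperm a b \o tperm b c) + T (X \o tperm b c \o tperm a b) = 0.

Lemma omap_tperm (I : finType) (a b : I) o :
  omap (tperm a b) o = tperm (Some a) (Some b) o.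
Proof. by case: o => [i|] /=; [rewrite (@inj_tperm I (option I) Some) //; exact: Some_inj | rewrite tpermD]. Qed.

Lemma cder_tperm (I : finType) (T : tens g I) a b X :
  cder T (X \o tperm (Some a) (Some b)) = cder (fun X => T (X \o tperm a b)) X.
Proof.
rewrite cder_bij; last by exists (tperm a b); exact: tpermK.
by congr (cder T (X \o _)); apply/funext => o; rewrite /= omap_tperm.
Qed.

Lemma anti_cder (I : finType) (T : tens g I) a b :
  anti T a b -> anti (cder T) (Some a) (Some b).
Proof.
by move=> Tab X; rewrite cder_tperm (cder_ext Tab) cderN.
Qed.

Lemma anti_bij (I J : finType) (h : I -> J) (T : tens g I) a b : bijective h ->
  anti T a b -> anti (fun X => T (X \o h)) (h a) (h b).
Proof.
move=> hB Tab X; rewrite -Tab; congr T; apply/funext => i /=.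
by rewrite inj_tperm //; exact: bij_inj.
Qed.

Lemma cyc3_cder (I : finType) (T : tens g I) a b c :
  cyc3 T a b c -> cyc3 (cder T) (Some a) (Some b) (Some c).
Proof.
move=> Tabc X; rewrite !cder_tperm -!cderD /cder !Tabc.
by under eq_bigr do rewrite Tabc; rewrite der0 big1 // subr0.
Qed.

Lemma cyc3_bij (I J : finType) (h : I -> J) (T : tens g I) a b c :
  bijective h -> cyc3 T a b c -> cyc3 (fun X => T (X \o h)) (h a) (h b) (h c).
Proof.
move=> hB Tabc X; have hI := bij_inj hB.
have E a' b' c' d' : X \o tperm (h a') (h b') \o tperm (h c') (h d') \o h =
    X \o h \o tperm a' b' \o tperm c' d'.
  by apply/funext => i /=; rewrite -!inj_tperm.
by rewrite !E Tabc.
Qed.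

End Nabla.
Arguments nab {n} g k X.

Section NablaSymmetries.
Variables (n : nat) (g : geometry n).
Local Notation E := (vf g).

Lemma newdir_inord k i : (i < 4)%N ->
  newdir (Some (inord i : 'I_k.+4)) = inord i.
Proof. by move=> i4; apply/val_inj; rewrite /= /bump !inordK //; lia. Qed.

(** The innermost direction stays in the last slot under all further derivatives; this is what lets
    the second Bianchi identity propagate. *)
Lemma newdir_max k : newdir (Some (ord_max : 'I_k.+4.+1)) = ord_max.
Proof. by apply/val_inj; rewrite /= /bump !inordK //; lia. Qed.

Lemma nab_anti01 k : anti (nab g k) (inord 0) (inord 1).
Proof.
elim: k => [X|k IHk].
  rewrite /= /riem /= !permE /= -!val_eqE /= !inordK //=.
  exact: curvop_anti12.
have := anti_bij (@newdir_bij k) (anti_cder IHk).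
by rewrite !newdir_inord.
Qed.

Lemma nab_anti23 k : anti (nab g k) (inord 2) (inord 3).
Proof.
elim: k => [X|k IHk].
  rewrite /= /riem /= !permE /= -!val_eqE /= !inordK //=.
  exact: curvop_anti34.
have := anti_bij (@newdir_bij k) (anti_cder IHk).
by rewrite !newdir_inord.
Qed.

Lemma nab_cyc012 k : cyc3 (nab g k) (inord 0) (inord 1) (inord 2).
Proof.
elim: k => [X|k IHk].
  rewrite /= /riem /= !permE /= -!val_eqE /= !inordK //=.
  exact: bianchi1.
have := cyc3_bij (@newdir_bij k) (cyc3_cder IHk).
by rewrite !newdir_inord.
Qed.

(** The correction for slot 3 is absorbed by metric compatibility, leaving the expression that
    [bianchi2] sums. *)
Lemma nab1E X : let x i := X (inord i) in nab g 1 X =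
  ip (cov (x 4) (curvop (x 0) (x 1) (x 2))) (x 3)
  - ip (curvop (cov (x 4) (x 0)) (x 1) (x 2)) (x 3)
  - ip (curvop (x 0) (cov (x 4) (x 1)) (x 2)) (x 3)
  - ip (curvop (x 0) (x 1) (cov (x 4) (x 2))) (x 3).
Proof.
move=> x /=; rewrite /cder.
have lift4 i : (i < 4)%N -> lift (inord 4) (inord i : 'I_4) = inord i :> 'I_5.
  by move=> i4; exact: (@newdir_inord 0).
have -> : (X \o @newdir 0) None = x 4 by [].
have Z i : (i < 4)%N -> (X \o @newdir 0 \o Some) (inord i) = x i.
  by move=> i4; rewrite /= lift4.
have -> (F : 'I_4 -> fn g) : \sum_i F i =
    F (inord 0) + F (inord 1) + F (inord 2) + F (inord 3).
  rewrite !big_ord_recl big_ord0 addr0 !addrA.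
  by do 3?[congr (_ + _)]; congr F; apply/val_inj; rewrite /= inordK.
rewrite /riem !repl_inord //= !lift4 // ip_compat -!/(x _).
by ring.
Qed.

(** The second Bianchi identity is exact for the derivative applied first, which sits in the last
    slot; outer derivatives preserve it. *)
Lemma nab_cyc01max k : cyc3 (nab g k.+1) (inord 0) (inord 1) ord_max.
Proof.
elim: k => [X|k IHk].
  rewrite !nab1E /=.
  have -> : ord_max = inord 4 :> 'I_5 by apply/val_inj; rewrite /= inordK.
  rewrite !permE /= -!val_eqE /= !inordK //=.
  by rewrite -[RHS](bianchi2 (X (inord 4)) (X (inord 0)) (X (inord 1)) (X (inord 2)) (X (inord 3))); ring.
have := cyc3_bij (@newdir_bij k.+1) (cyc3_cder IHk).
by rewrite !newdir_inord // newdir_max.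
Qed.

End NablaSymmetries.

(** * Quadratic expressions *)

Section Quadratic.
Variable n : nat.

(* Index sets are arbitrary finite types, so that products, contractions and
   derivatives need no arithmetic of slots. *)
Inductive quad (k : nat) :
    forall I : finType, (forall g : geometry n, tens g I) -> Prop :=
| quad_prod a b of (a.+2 <= k)%N & (b.+2 <= k)%N :
    quad k (fun g => tprod (nab g a) (nab g b))
| quad_bij (I J : finType) (h : I -> J) T of bijective h & quad k T :
    @quad k J (fun g X => T g (X \o h))
| quad_contr (I : finType) T of @quad k (option (option I)) T :
    @quad k I (fun g => tcontr (T g))
| quad0 (I : finType) : @quad k I (fun g X => 0)
| quad_add (I : finType) T S of @quad k I T & @quad k I S :
    @quad k I (fun g X => T g X + S g X)
| quad_opp (I : finType) T of @quad k I T : @quad k I (fun g X => - T g X).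

Lemma quad_ext k (I : finType) (T S : forall g : geometry n, tens g I) :
  (forall g X, T g X = S g X) -> quad k T -> quad k S.
Proof.
move=> TS; suff -> : T = S by [].
by apply/functional_extensionality_dep => g; apply/funext => X.
Qed.

Lemma quad_sum k (I J : finType) (T : J -> forall g : geometry n, tens g I) :
  (forall j, quad k (T j)) -> quad k (fun g X => \sum_j T j g X).
Proof.
move=> Tq; elim: (index_enum J) => [|j r IHr].
  by apply: quad_ext (quad0 k I) => g X; rewrite big_nil.
by apply: quad_ext (quad_add (Tq j) IHr) => g X; rewrite big_cons.
Qed.

Lemma quad_multilin k (I : finType) (T : forall g : geometry n, tens g I) :
  quad k T -> forall g, multilin (T g).
Proof.
elim => {I T} [a b _ _ g|I J h T hB _ IH g|I T _ IH g|I g|I T S _ IHT _ IHS g|I T _ IH g].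
- exact: tprod_multilin (@nab_multilin _ g a) (@nab_multilin _ g b).
- exact: multilin_bij.
- exact: tcontr_multilin.
- by move=> X i f Y Z; rewrite mulr0 addr0.
- by move=> X i f Y Z; rewrite IHT IHS; ring.
- by move=> X i f Y Z; rewrite IH; ring.
Qed.

(** Differentiating a factor raises its order by one, which the passage from [k] to [k.+1] absorbs.
    The bijection [h] identifies the direction slot [None] with slot 4 of [nab g a.+1]. *)
Lemma quad_leibniz k a b : (a.+2 <= k)%N -> (b.+2 <= k)%N ->
  quad k.+1 (fun g X => cder (nab g a) (X \o omap inl)
                        * nab g b (X \o (Some \o inr))).
Proof.
move=> ak bk.
pose h (i : ('I_a.+4.+1 + 'I_b.+4)%type) : option ('I_a.+4 + 'I_b.+4)%type :=
  match i with inl i => omap inl (unlift (inord 4) i) | inr j => Some (inr j) end.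
have hB : bijective h.
  exists (fun o => match o with
    | None => inl (newdir None) | Some (inl i) => inl (newdir (Some i))
    | Some (inr j) => inr j end).
    case=> [i|//]; rewrite /h /=.
    by case: unliftP => [j|] ->.
  case=> [[i|j]|] //; rewrite /h.
    by rewrite newdirK.
  by rewrite newdirK.
apply: quad_ext (quad_bij hB (@quad_prod k.+1 a.+1 b _ _)) => [g X||]; [|lia|lia].
rewrite /tprod /=; congr (cder _ _ * _).
by apply/funext => o; rewrite /= newdirK.
Qed.

Lemma quad_cder k (I : finType) (T : forall g : geometry n, tens g I) :
  quad k T -> quad k.+1 (fun g => cder (T g)).
Proof.
elim => {I T} [a b ak bk|I J h T hB _ IH|I T Tq IH|I|I T S _ IHT _ IHS|I T _ IH].
(* The second Leibniz term is the first one with the factors exchanged, up to this relabelling of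
   slots. *)
- have swapB : bijective (omap (fun i : 'I_b.+4 + 'I_a.+4 =>
       match i return ('I_a.+4 + 'I_b.+4)%type with inl j => inr j | inr j => inl j end)).
    by exists (omap (fun i => match i with inl j => inr j | inr j => inl j end));
       move=> [[]|].
  apply: quad_ext (quad_add (quad_leibniz ak bk)
                   (quad_bij swapB (quad_leibniz bk ak))) => g X.
  by rewrite cder_tprod [X in _ + X]mulrC; congr (_ + _ * _).
- have ohB : bijective (omap h).
    by case: hB => h' hK h'K; exists (omap h'); [exact: omapK | exact: omapK].
  by apply: quad_ext (quad_bij ohB IH) => g X; rewrite -cder_bij.
- have rotB : bijective (@rot_opt I).
    exists (fun o : option (option (option I)) => match o with
       | None => Some None | Some None => Some (Some None)
       | Some (Some None) => None | _ => o end); by move=> [[[i|]|]|].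
  apply: quad_ext (quad_contr (quad_bij rotB IH)) => g X.
  by rewrite cder_tcontr //; exact: quad_multilin Tq g.
- by apply: quad_ext (quad0 k.+1 _) => g X; rewrite /cder der0 big1 // subr0.
- by apply: quad_ext (quad_add IHT IHS) => g X; rewrite cderD.
- by apply: quad_ext (quad_opp IH) => g X; rewrite cderN.
Qed.

End Quadratic.

(** * Commuting the directions of differentiation *)

Section Commutation.
Variable n : nat.

(** Slots of the product of R and nabla^k R in the i-th Ricci term: R receives the two directions
    and the i-th argument, while its slot 3 and slot i of nabla^k R form the outermost pair, ready
    for contraction. *)
Definition ricci_slot k (i : 'I_k.+4) (j : 'I_4 + 'I_k.+4) :
    option (option (option (option 'I_k.+4))) :=
  match j with
  | inl j => match val j with
             | 0 => Some (Some None)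
             | 1 => Some (Some (Some None))
             | 2 => Some (Some (Some (Some i)))
             | _ => None
             end
  | inr l => if l == i then Some None else Some (Some (Some (Some l)))
  end.

Lemma ricci_slot_bij k (i : 'I_k.+4) : bijective (ricci_slot i).
Proof.
apply: inj_card_bij; last by rewrite !card_option card_sum !card_ord.
move=> [j|j] [l|l] /=.
- move: j l => [[|[|[|[|//]]]] ?] [[|[|[|[|//]]]] ?] //= _; congr inl; exact: val_inj.
- by case: j => [[|[|[|[|//]]]] ?] /=; case: eqP => // li [] /esym.
- by case: l => [[|[|[|[|//]]]] ?] /=; case: eqP => // li [].
- by case: eqP => [->|_]; case: eqP => [->|_] // [->].
Qed.

(** Expanding the curvature vector in the dual frame displays each summand as a metric contraction
    of R with nabla^k R. The order k is the highest that [quad k.+2] admits. *)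
Lemma quad_ricci k : quad k.+2 (fun (g : geometry n) X =>
  \sum_i nab g k (repl (X \o Some \o Some) i
           (curvop (X None) (X (Some None)) (X (Some (Some i)))))).
Proof.
apply: quad_sum => i.
have prodq := quad_bij (ricci_slot_bij i) (@quad_prod n k.+2 0 k isT (leqnn _)).
apply: quad_ext (quad_contr prodq) => g X; symmetry; rewrite /tcontr.
rewrite [curvop _ _ _]coframe_expand (multilin_sum (@nab_multilin _ g k)).
apply: eq_bigr => p _; rewrite scaler_sumr (multilin_sum (@nab_multilin _ g k)).
apply: eq_bigr => q _; rewrite scalerA (multilinZ (@nab_multilin _ g k)).
rewrite (mulrC (ip _ _)) -mulrA /tprod; congr (_ * (_ * _)).
  by rewrite /= /riem /= /ricci_slot /= !inordK.
by congr nab; apply/funext => l; rewrite /= /repl; case: eqP.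
Qed.

Lemma nab2E (g : geometry n) k X : nab g k.+2 X =
  cder (cder (nab g k)) (X \o @newdir k.+1 \o omap (@newdir k)).
Proof. by rewrite /= cder_bij //; exact: newdir_bij. Qed.

(** A new direction entering at slot 4 pushes every older direction one slot further. *)
Lemma tperm_inord_newdir k i : (i.+1 < k.+4)%N -> (3 < i)%N ->
  tperm (inord i.+1) (inord i.+2) \o @newdir k =
  @newdir k \o omap (tperm (inord i : 'I_k.+4) (inord i.+1)).
Proof.
move=> ik i4; apply/funext => o; rewrite /= omap_tperm.
rewrite inj_tperm; last exact: can_inj (@newdirK k).
by congr (tperm _ _ _); apply/val_inj; rewrite /= /bump !inordK //; lia.
Qed.

(* Exchanging two consecutive directions of differentiation costs a quadratic
   term, by the Ricci identity for the outermost pair, and by differentiating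
   that identity for the inner ones. *)
Lemma quad_swap k i : (3 < i)%N -> (i.+1 < k.+4)%N ->
  quad k (fun (g : geometry n) X =>
    nab g k (X \o tperm (inord i : 'I_k.+4) (inord i.+1)) - nab g k X).
Proof.
elim: k i => [|k IHk] i i4 ik; first by lia.
have [i_eq4|i_neq4] := eqVneq i 4.
  subst i; case: k IHk ik => [//|k] _ _.
  pose w := @newdir k.+1 \o omap (@newdir k).
  have wB : bijective w.
    apply: bij_comp; first exact: newdir_bij.
    have [h' hK h'K] := @newdir_bij k.
    by exists (omap h'); [exact: omapK | exact: omapK].
  pose tau : option (option 'I_k.+4) -> _ := tperm None (Some None).
  have tauB : bijective tau by exists tau; exact: tpermK.
  have wtau : tperm (inord 4) (inord 5) \o w = w \o tau.
    rewrite -[inord 4]/(w None); have -> : inord 5 = w (Some None).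
      by apply/val_inj; rewrite /= /bump !inordK.
    by apply/funext => o; rewrite /= -(inj_tperm _ _ _ (bij_inj wB)).
  apply: quad_ext (quad_opp (quad_bij (bij_comp wB tauB) (quad_ricci k))) => g X.
  rewrite 2!nab2E; have -> : X \o tperm (inord 4) (inord 5) \o @newdir k.+1 \o
      omap (@newdir k) = X \o (w \o tau) by rewrite -wtau.
  rewrite -[X \o _ \o omap _]/(X \o w).
  have -> : X \o w = ocons (X (w None)) (ocons (X (w (Some None)))
      (X \o (w \o tau) \o Some \o Some)).
    by apply/funext => -[[i|]|] //=; rewrite /tau tpermD.
  have -> : X \o (w \o tau) = ocons (X (w (Some None))) (ocons (X (w None))
      (X \o (w \o tau) \o Some \o Some)).
    by apply/funext => -[[i|]|] //=; rewrite /tau ?tpermL ?tpermR.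
  by rewrite (ricci_identity (@nab_multilin _ g k)).
case: i i4 ik i_neq4 => [//|i] i4 ik i_neq4.
have i3 : (3 < i)%N by lia.
have ik' : (i.+1 < k.+4)%N by lia.
apply: quad_ext (quad_bij (@newdir_bij k) (quad_cder (IHk i i3 ik'))) => g X.
rewrite cderD cderN /=; have -> : X \o tperm (inord i.+1) (inord i.+2) \o @newdir k
    = X \o @newdir k \o omap (tperm (inord i) (inord i.+1)).
  by apply/funext => o; rewrite /= -[tperm _ _ _]/((_ \o @newdir k) o) tperm_inord_newdir.
rewrite cder_bij //.
by exists (tperm (inord i) (inord i.+1)); exact: tpermK.
Qed.

End Commutation.

(** * From the predicate [quad] to explicit lists of monomials *)

Section Expressions.
Variable n : nat.

Definition acons (T : Type) m (Y : T) (X : 'I_m -> T) : 'I_m.+1 -> T :=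
  fun i => if unlift ord0 i is Some j then X j else Y.

Fixpoint qmon_eval k m (q : qmonomial k m) (g : geometry n) : tens g 'I_m :=
  match q with
  | QProd a b _ _ => fun X =>
      nab g a (fun i => X (lshift b.+4 i)) * nab g b (fun i => X (rshift a.+4 i))
  | QPerm _ s q' => fun X => qmon_eval q' (fun i => X (s i))
  | QContr _ q' => fun X => \sum_i \sum_j cometric g i j *
      qmon_eval q' (acons (frame g i) (acons (frame g j) X))
  end.

(** An arbitrary numbering [h] of the slots is carried through the induction; it absorbs [quad_bij],
    so a permutation is inserted only at the products. Integer coefficients suffice because [quad]
    only adds and negates. The list is chosen before the geometry. *)
Lemma quad_qmonomials k (I : finType) (T : forall g : geometry n, tens g I) :
  quad k T -> forall m (h : I -> 'I_m), bijective h ->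
  exists B : seq (int * qmonomial k m), forall g X,
    T g (X \o h) = \sum_(c <- B) qmon_eval c.2 X *~ c.1.
Proof.
elim => {I T} [a b ak bk|I J f T fB _ IH|I T _ IH|I|I T S _ IHT _ IHS|I T _ IH] m h hB.
- have em : m = (a.+4 + b.+4)%N.
    by have := bij_eq_card hB; rewrite card_sum !card_ord.
  subst m; have fI : injective (h \o @fintype.split a.+4 b.+4).
    apply: inj_comp (bij_inj hB) (can_inj (@splitK _ _)).
  exists [:: (1, QPerm (perm fI) (QProd ak bk))] => g X.
  rewrite big_seq1 /= /tprod; congr (_ * _); congr nab; apply/funext => i.
    by rewrite permE /= (unsplitK (inl i)).
  by rewrite permE /= (unsplitK (inr i)).
- by have [B BE] := IH m (h \o f) (bij_comp hB fB); exists B => g X; rewrite -BE.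
(* The contracted pair is numbered 0 and 1, as [QContr] expects. *)
- pose h2 (o : option (option I)) : 'I_m.+2 := match o with
    | None => ord0 | Some None => lift ord0 ord0
    | Some (Some i) => lift ord0 (lift ord0 (h i)) end.
  have h2B : bijective h2.
    have [h' hK h'K] := hB.
    exists (fun i : 'I_m.+2 => if unlift ord0 i is Some j then
               Some (if unlift ord0 j is Some l then Some (h' l) else None)
             else None).
      by case=> [[i|]|]; rewrite /h2 ?liftK ?unlift_none ?hK.
    move=> i; case: (unliftP ord0 i) => [j|] -> //.
    by case: (unliftP ord0 j) => [l|] -> //=; rewrite h'K.
  have [B BE] := IH _ _ h2B.
  exists [seq (c.1, QContr c.2) | c <- B] => g X; rewrite big_map /tcontr /=.
  under [RHS]eq_bigr do rewrite mulrz_suml.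
  rewrite [RHS]exchange_big; apply: eq_bigr => p _.
  under [RHS]eq_bigr do rewrite mulrz_suml.
  rewrite [RHS]exchange_big; apply: eq_bigr => q _.
  have -> : ocons (frame g p) (ocons (frame g q) (X \o h)) =
      acons (frame g p) (acons (frame g q) X) \o h2.
    by apply/funext => -[[i|]|]; rewrite /= /acons ?liftK ?unlift_none.
  by rewrite BE mulr_sumr; apply: eq_bigr => c _; rewrite mulrzAr.
- by exists [::] => g X; rewrite big_nil.
- have [BT BTE] := IHT _ _ hB; have [BS BSE] := IHS _ _ hB.
  by exists (BT ++ BS) => g X; rewrite big_cat /= BTE BSE.
- have [B BE] := IH _ _ hB; exists [seq (- c.1, c.2) | c <- B] => g X.
  by rewrite big_map BE -sumrN; apply: eq_bigr => c _; rewrite mulrNz.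
Qed.

End Expressions.

(** * Smooth functions on an open set *)

Section SmoothFunctions.
Context {R : realType} {n : nat} (V : set 'rV[R]_n).
Hypothesis Vopen : open V.
Implicit Types (f g : 'rV[R]_n -> R) (x y : 'rV[R]_n).

Lemma near_eq_on f g x : (forall y, V y -> f y = g y) -> V x ->
  \near x, f x = g x.
Proof.
move=> fg Vx; near=> y; apply: fg; near: y; exact: open_nbhs_nbhs.
Unshelve. all: by end_near. Qed.

Lemma pd_eq_on f g i : (forall y, V y -> f y = g y) ->
  forall x, V x -> pd i f x = pd i g x.
Proof. by move=> fg x Vx; apply/near_eq_derive/near_eq_on. Qed.

Lemma derivable_eq_on f g i : (forall y, V y -> f y = g y) ->
  forall x, V x -> derivable f x (delta_mx 0 i) -> derivable g x (delta_mx 0 i).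
Proof. by move=> fg x Vx; apply/near_eq_derivable/near_eq_on. Qed.

Lemma continuous_eq_on f g : (forall y, V y -> f y = g y) ->
  forall x, V x -> {for x, continuous f} -> {for x, continuous g}.
Proof.
move=> fg x Vx fc; rewrite /prop_for /continuous_at -(fg _ Vx).
apply: cvg_trans fc; exact: (near_eq_cvg (near_eq_on fg Vx)).
Qed.

Lemma smooth_cont f x : smooth_on V f -> V x -> {for x, continuous f}.
Proof. by move=> fs Vx; have [] := fs [::] x Vx. Qed.

Lemma smooth_derivable f x i :
  smooth_on V f -> V x -> derivable f x (delta_mx 0 i).
Proof. by move=> fs Vx; have [_] := fs [::] x Vx. Qed.

Lemma smooth_pd f i : smooth_on V f -> smooth_on V (pd i f).
Proof. by move=> fs s x Vx; have := fs (rcons s i) x Vx; rewrite foldr_rcons. Qed.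

(** Smoothness speaks of all iterated partial derivatives, so it does not pass directly to products
    and inverses. This class is closed under the operations and, up to equality on [V], under [pd],
    which makes the induction on the number of derivatives work. *)
Inductive smooth_gen : ('rV[R]_n -> R) -> Prop :=
| sg_base f of smooth_on V f : smooth_gen f
| sg_cst c : smooth_gen (cst c)
| sg_add f g of smooth_gen f & smooth_gen g : smooth_gen (f \+ g)
| sg_opp f of smooth_gen f : smooth_gen (\- f)
| sg_mul f g of smooth_gen f & smooth_gen g : smooth_gen (f \* g)
| sg_inv f of (forall x, V x -> f x != 0) & smooth_gen f :
    smooth_gen (fun x => (f x)^-1).

Lemma smooth_gen_cont f x : smooth_gen f -> V x -> {for x, continuous f}.
Proof.
move=> fs Vx; elim: fs => {f} [f fs|c|f g _ fc _ gc|f _ fc|f g _ fc _ gc|f f0 _ fc].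
- exact: smooth_cont.
- exact: cst_continuous.
- exact: continuousD.
- exact: continuousN.
- exact: continuousM.
- by apply: continuousV => //; exact: f0.
Qed.

Lemma smooth_gen_derivable f x i :
  smooth_gen f -> V x -> derivable f x (delta_mx 0 i).
Proof.
move=> fs Vx; elim: fs => {f} [f fs|c|f g _ fc _ gc|f _ fc|f g _ fc _ gc|f f0 _ fc].
- exact: smooth_derivable.
- exact: derivable_cst.
- exact: derivableD.
- exact: derivableN.
- exact: derivableM.
- by apply: derivableV => //; exact: f0.
Qed.

Lemma pdD f g i x : derivable f x (delta_mx 0 i) -> derivable g x (delta_mx 0 i) ->
  pd i (f \+ g) x = pd i f x + pd i g x.
Proof. exact: deriveD. Qed.

Lemma pdN f i x : derivable f x (delta_mx 0 i) -> pd i (\- f) x = - pd i f x.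
Proof. exact: deriveN. Qed.

Lemma pdM f g i x : derivable f x (delta_mx 0 i) -> derivable g x (delta_mx 0 i) ->
  pd i (f \* g) x = pd i f x * g x + f x * pd i g x.
Proof.
by move=> df dg; rewrite /pd deriveM // addrC mulrC; congr (_ + _).
Qed.

Lemma smooth_gen_pd f i : smooth_gen f ->
  exists2 g, smooth_gen g & forall x, V x -> pd i f x = g x.
Proof.
elim=> {f} [f fs|c|f g fs [f' f's fE] gs [g' g's gE]|f fs [f' f's fE]
  |f g fs [f' f's fE] gs [g' g's gE]|f f0 fs [f' f's fE]].
- by exists (pd i f) => //; apply/sg_base/smooth_pd.
- by exists (cst 0); [exact: sg_cst | move=> x _; exact: derive_cst].
- exists (f' \+ g'); first exact: sg_add.
  by move=> x Vx /=; rewrite pdD ?fE ?gE //; exact: smooth_gen_derivable.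
- exists (\- f'); first exact: sg_opp.
  by move=> x Vx /=; rewrite pdN ?fE //; exact: smooth_gen_derivable.
- exists (f' \* g \+ f \* g'); first by apply: sg_add; exact: sg_mul.
  by move=> x Vx /=; rewrite pdM ?fE ?gE //; exact: smooth_gen_derivable.
- pose fV := fun x => (f x)^-1; have fVs : smooth_gen fV by exact: sg_inv.
  exists (\- (fV \* fV \* f')); first exact/sg_opp/sg_mul/f's/sg_mul.
  move=> x Vx; rewrite /pd deriveV; [|exact: f0|exact: smooth_gen_derivable].
  by rewrite -/(pd i f x) fE // /fV /= -expr2 -exprVn scaleNr.
Qed.

Lemma smooth_genP f : smooth_gen f -> smooth_on V f.
Proof.
move=> fs s; have [g gs fE] : exists2 g, smooth_gen g &
    forall x, V x -> foldr pd f s x = g x.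
  elim: s => [|i s [g gs gE]] /=; first by exists f.
  have [g' g's g'E] := smooth_gen_pd i gs; exists g' => // x Vx.
  by rewrite -g'E //; exact: pd_eq_on.
have gE x : V x -> g x = foldr pd f s x by move=> Vx; rewrite fE.
move=> x Vx; split.
  by apply: (continuous_eq_on gE) => //; exact: smooth_gen_cont.
by move=> i; apply: (derivable_eq_on gE) => //; exact: smooth_gen_derivable.
Qed.

Lemma smooth_eq f g : (forall x, V x -> f x = g x) -> smooth_on V f ->
  smooth_on V g.
Proof.
move=> fg fs s x Vx.
have fgs y : V y -> foldr pd f s y = foldr pd g s y.
  by elim: s y => [|i s IHs] y Vy /=; [exact: fg | exact: pd_eq_on].
have [fc fd] := fs s x Vx; split; first exact: continuous_eq_on fc.
by move=> i; apply: (derivable_eq_on fgs) => //; exact: fd.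
Qed.

Lemma line_derive f i y (s : R) : derivable f (s *: delta_mx 0 i + y) (delta_mx 0 i) ->
  is_derive s 1 (fun s : R => f (s *: delta_mx 0 i + y))
    (pd i f (s *: delta_mx 0 i + y)).
Proof.
set e := delta_mx 0 i => fd.
have E : (fun h : R => h^-1 *: (((fun s : R => f (s *: e + y)) \o shift s) (h *: 1) -
     f (s *: e + y))) =
   (fun h : R => h^-1 *: ((f \o shift (s *: e + y)) (h *: e) - f (s *: e + y))).
  apply/funext => h /=; congr (_ *: (f _ - _)).
  by rewrite [h *: 1]mulr1 scalerDl addrA.
by apply: DeriveDef; rewrite /derivable /derive E.
Qed.

(** * Symmetry of the second partial derivatives *)

Section MixedDifference.
Variables (f : 'rV[R]_n -> R) (i j : 'I_n) (x : 'rV[R]_n) (t : R).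
Hypothesis fs : smooth_on V f.
Hypothesis t0 : 0 < t.
Let e := delta_mx 0 i : 'rV[R]_n.
Let e' := delta_mx 0 j : 'rV[R]_n.
Hypothesis box : forall a b, 0 <= a <= t -> 0 <= b <= t -> V (b *: e' + (a *: e + x)).

(** The mean value theorem is used twice: for the difference [F] of two parallel lines in direction
    [e], then for [pd i f] in direction [e']. *)
Lemma mixed_difference : exists a b, [/\ 0 <= a <= t, 0 <= b <= t &
  f (t *: e' + (t *: e + x)) - f (t *: e + x) - f (t *: e' + x) + f x
  = pd j (pd i f) (b *: e' + (a *: e + x)) * t * t].
Proof.
have t0' := ltW t0.
have box' a b : 0 <= a <= t -> 0 <= b <= t -> V (a *: e + (b *: e' + x)).
  by move=> ha hb; rewrite addrCA; exact: box.
have box0 a : 0 <= a <= t -> V (a *: e + x).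
  by move=> ha; have := @box a 0 ha; rewrite scale0r add0r lexx t0'; exact.
pose F (a : R) := f (a *: e + (t *: e' + x)) - f (a *: e + x).
pose dF (a : R) := pd i f (a *: e + (t *: e' + x)) - pd i f (a *: e + x).
have Fd a : 0 <= a <= t -> is_derive a 1 F (dF a).
  move=> ha; apply: is_deriveB; apply: line_derive; apply: smooth_derivable => //.
    by apply: box'; rewrite ?lexx ?t0'.
  exact: box0.
have [||a] := @MVT _ F dF 0 t t0.
- by move=> a; rewrite in_itv /= => /andP[/ltW ? /ltW ?]; apply: Fd; apply/andP.
- by apply: derivable_within_continuous => a; rewrite in_itv /= => /Fd [].
rewrite in_itv /= => /andP[/ltW a0 /ltW at1]; rewrite subr0 => FE.
have ha : 0 <= a <= t by rewrite a0.
pose G (b : R) := pd i f (b *: e' + (a *: e + x)).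
pose dG (b : R) := pd j (pd i f) (b *: e' + (a *: e + x)).
have Gd b : 0 <= b <= t -> is_derive b 1 G (dG b).
  move=> hb; apply: line_derive; apply: smooth_derivable; first exact: smooth_pd.
  exact: box.
have [||b] := @MVT _ G dG 0 t t0.
- by move=> b; rewrite in_itv /= => /andP[/ltW ? /ltW ?]; apply: Gd; apply/andP.
- by apply: derivable_within_continuous => b; rewrite in_itv /= => /Gd [].
rewrite in_itv /= => /andP[/ltW b0 /ltW bt]; rewrite subr0 => GE.
exists a, b; split=> //; first by rewrite b0.
rewrite -/(dG b) -GE; have -> : G t - G 0 = dF a.
  by rewrite /G /dF scale0r add0r addrCA.
by rewrite -FE /F !scale0r !add0r (addrCA (t *: e')); ring.
Qed.

End MixedDifference.

(** The second difference is symmetric in the two directions, so the two mixed derivatives take a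
    common value at two points of a small box at [x]; continuity brings both to [x]. *)
Lemma pd_comm f i j x : smooth_on V f -> V x ->
  pd i (pd j f) x = pd j (pd i f) x.
Proof.
move=> fs Vx; apply/eqP; rewrite -subr_eq0 -normr_le0.
apply/ler_addgt0Pl => eps eps0; rewrite addr0.
have eps2 : 0 < eps / 2 by rewrite divr_gt0.
have c1 := smooth_cont (smooth_pd i (smooth_pd j fs)) Vx.
have c2 := smooth_cont (smooth_pd j (smooth_pd i fs)) Vx.
have {}c1 : nbhs x [set y | `|pd i (pd j f) x - pd i (pd j f) y| < eps / 2].
  by move/cvgrPdist_lt : c1 => /(_ _ eps2).
have {}c2 : nbhs x [set y | `|pd j (pd i f) x - pd j (pd i f) y| < eps / 2].
  by move/cvgrPdist_lt : c2 => /(_ _ eps2) {}c1.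
have c0 : nbhs x V by exact: open_nbhs_nbhs.
have [r /= r0 Hr] := (nbhs_ballP _ _).1 (filterI c0 (filterI c1 c2)).
(* The box of side [t = r / (2 N)] must fit into the ball of radius [r]; the summand 1 makes [N]
   positive and the inclusion strict. *)
pose N := `|delta_mx 0 i : 'rV[R]_n| + `|delta_mx 0 j : 'rV[R]_n| + 1.
have N0 : 0 < N by rewrite ltr_wpDl // addr_ge0.
pose t := r / N / 2; have t0 : 0 < t by rewrite !divr_gt0.
have close p q a b : (p = i /\ q = j) \/ (p = j /\ q = i) ->
    0 <= a <= t -> 0 <= b <= t ->
    ball x r (b *: delta_mx 0 q + (a *: delta_mx 0 p + x)).
  move=> pq /andP[a0 at1] /andP[b0 bt]; rewrite -ball_normE /ball_ /=.
  rewrite !opprD addrA addrC addrA addrNK -opprD normrN.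
  apply: le_lt_trans (ler_normD _ _) _; rewrite !normrZ !ger0_norm //.
  have -> : r = t * N + t * N by rewrite -mulrDl -splitr mulfVK // gt_eqF.
  apply: (@le_lt_trans _ _ (t * N - t)); last by have := mulr_gt0 t0 N0; lra.
  have -> : t * N - t = t * `|delta_mx 0 p : 'rV[R]_n| + t * `|delta_mx 0 q : 'rV[R]_n|.
    by rewrite /N; case: pq => -[-> ->]; ring.
  by apply: lerD; rewrite ler_wpM2r.
have Vbox p q (pq : (p = i /\ q = j) \/ (p = j /\ q = i)) a b :
    0 <= a <= t -> 0 <= b <= t -> V (b *: delta_mx 0 q + (a *: delta_mx 0 p + x)).
  by move=> ha hb; have [] := Hr _ (close p q a b pq ha hb).
have ij : (i = i /\ j = j) \/ (i = j /\ j = i) by left.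
have ji : (j = i /\ i = j) \/ (j = j /\ i = i) by right.
have [a [b [ha hb E1]]] := mixed_difference fs t0 (Vbox i j ij).
have [a' [b' [ha' hb' E2]]] := mixed_difference fs t0 (Vbox j i ji).
have [_ [_ h1]] := Hr _ (close i j a b ij ha hb).
have [_ [h2 _]] := Hr _ (close j i a' b' ji ha' hb').
rewrite /= in h1 h2.
move: (pd j (pd i f) (_ + _)) (pd i (pd j f) (_ + _)) E1 E2 h1 h2.
move: (pd j (pd i f) x) (pd i (pd j f) x) => u v p q E1 E2 h1 h2.
have pq : p = q.
  have tn0 : t != 0 by rewrite gt_eqF.
  apply/(mulIf tn0)/(mulIf tn0); rewrite -E1 -E2 (addrCA (t *: delta_mx 0 i)).
  by ring.
have -> : v - u = (v - q) - (u - p) by rewrite pq; ring.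
apply: le_trans (ler_normB _ _) _; rewrite [leRHS]splitr.
by apply: lerD; [exact: ltW h2 | exact: ltW h1].
Qed.

End SmoothFunctions.

(** * The commutative ring of smooth functions on an open set *)

Section SmoothRing.
Context {R : realType} {n : nat} (V : set 'rV[R]_n) (Vopen : open V).

(* Functions on V, represented by their extension by 0. *)
Record smoothfun (Vo : open V) := SFun {
  sfun_val :> 'rV[R]_n -> R;
  sfunP : `[< smooth_on V sfun_val /\ forall x, ~ V x -> sfun_val x = 0 >] }.

HB.instance Definition _ := [isSub for (@sfun_val Vopen)].
HB.instance Definition _ := [Choice of smoothfun Vopen by <:].
Local Notation S := (smoothfun Vopen).
Implicit Types (f g h : S) (x : 'rV[R]_n).

Lemma sfun_smooth f : smooth_on V f.
Proof. by have /asboolP[] := sfunP f. Qed.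

(** The normalization by 0 outside [V] makes agreement on [V] an equality, as the ring laws
    require. *)
Lemma sfun_ext f g : (forall x, V x -> f x = g x) -> f = g.
Proof.
move=> fg; apply/val_inj/funext => x /=.
have [Vx|nVx] := pselect (V x); first exact: fg.
have /asboolP[_ ->//] := sfunP f.
by have /asboolP[_ ->] := sfunP g.
Qed.

Lemma restr_subproof (u : 'rV[R]_n -> R) : smooth_on V u ->
  `[< smooth_on V (u \_ V) /\ forall x, ~ V x -> (u \_ V) x = 0 >].
Proof.
move=> us; apply/asboolP; split=> [|x nVx].
  by apply: (smooth_eq Vopen _ us) => x Vx; rewrite patchE mem_set.
by rewrite patchE memNset.
Qed.

Definition restr (u : 'rV[R]_n -> R) (us : smooth_on V u) : S :=
  SFun Vopen (restr_subproof us).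

Lemma restrE u (us : smooth_on V u) x : V x -> restr us x = u x.
Proof. by move=> Vx; rewrite /= patchE mem_set. Qed.

Let smooth_sum f g := smooth_genP Vopen (sg_add (sg_base (sfun_smooth f)) (sg_base (sfun_smooth g))).
Let smooth_mul f g := smooth_genP Vopen (sg_mul (sg_base (sfun_smooth f)) (sg_base (sfun_smooth g))).
Let smooth_opp f := smooth_genP Vopen (sg_opp (sg_base (sfun_smooth f))).

Definition sfun_cst c : S := restr (smooth_genP Vopen (sg_cst V c)).
Definition sfun_add f g : S := restr (smooth_sum f g).
Definition sfun_mul f g : S := restr (smooth_mul f g).
Definition sfun_opp f : S := restr (smooth_opp f).

Let cstE c x : V x -> sfun_cst c x = c. Proof. exact: restrE. Qed.
Let addE f g x : V x -> sfun_add f g x = f x + g x. Proof. exact: restrE. Qed.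
Let mulE f g x : V x -> sfun_mul f g x = f x * g x. Proof. exact: restrE. Qed.
Let oppE f x : V x -> sfun_opp f x = - f x. Proof. exact: restrE. Qed.
Let valE := (addE, mulE, oppE, cstE).

Lemma sfun_addA : associative sfun_add.
Proof. by move=> f g h; apply: sfun_ext => x Vx; rewrite !valE // addrA. Qed.

Lemma sfun_addC : commutative sfun_add.
Proof. by move=> f g; apply: sfun_ext => x Vx; rewrite !valE // addrC. Qed.

Lemma sfun_add0 : left_id (sfun_cst 0) sfun_add.
Proof. by move=> f; apply: sfun_ext => x Vx; rewrite !valE // add0r. Qed.

Lemma sfun_addN : left_inverse (sfun_cst 0) sfun_opp sfun_add.
Proof. by move=> f; apply: sfun_ext => x Vx; rewrite !valE // addNr. Qed.

HB.instance Definition _ := GRing.isZmodule.Build S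
  sfun_addA sfun_addC sfun_add0 sfun_addN.

Lemma sfun_mulA : associative sfun_mul.
Proof. by move=> f g h; apply: sfun_ext => x Vx; rewrite !valE // mulrA. Qed.

Lemma sfun_mulC : commutative sfun_mul.
Proof. by move=> f g; apply: sfun_ext => x Vx; rewrite !valE // mulrC. Qed.

Lemma sfun_mul1 : left_id (sfun_cst 1) sfun_mul.
Proof. by move=> f; apply: sfun_ext => x Vx; rewrite !valE // mul1r. Qed.

Lemma sfun_mulD : left_distributive sfun_mul sfun_add.
Proof. by move=> f g h; apply: sfun_ext => x Vx; rewrite !valE // mulrDl. Qed.

HB.instance Definition _ := GRing.Zmodule_isComPzRing.Build S
  sfun_mulA sfun_mulC sfun_mul1 sfun_mulD.

Definition spd i f : S := restr (smooth_pd i (sfun_smooth f)).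

Section Values.
Variable x : 'rV[R]_n.
Hypothesis Vx : V x.

Lemma sval0 : (0 : S) x = 0. Proof. exact: restrE. Qed.
Lemma sval1 : (1 : S) x = 1. Proof. exact: restrE. Qed.
Lemma svalD f g : (f + g) x = f x + g x. Proof. exact: restrE. Qed.
Lemma svalM f g : (f * g) x = f x * g x. Proof. exact: restrE. Qed.
Lemma svalN f : (- f) x = - f x. Proof. exact: restrE. Qed.
Lemma spdE i f : spd i f x = pd i f x. Proof. exact: restrE. Qed.

Lemma svalB f g : (f - g) x = f x - g x. Proof. by rewrite svalD svalN. Qed.

Lemma sval_sum (I : Type) (r : seq I) (P : pred I) (F : I -> S) :
  (\sum_(i <- r | P i) F i) x = \sum_(i <- r | P i) F i x.
Proof. exact: (big_morph (fun f : S => f x) svalD sval0). Qed.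

Lemma sval_mulz f (c : int) : (f *~ c) x = f x * c%:~R.
Proof.
have nat_case m : (f *+ m) x = f x *+ m.
  by elim: m => [|m IHm]; rewrite ?mulr0n ?sval0 // !mulrS svalD IHm.
case: c => m; first by rewrite -pmulrn nat_case mulr_natr.
by rewrite NegzE !mulrNz svalN -!pmulrn nat_case mulrN mulr_natr.
Qed.

End Values.

Lemma spdD i f g : spd i (f + g) = spd i f + spd i g.
Proof.
apply: sfun_ext => x Vx; rewrite svalD // !spdE //.
have df := @smooth_derivable _ _ V _ x i (sfun_smooth f) Vx.
have dg := @smooth_derivable _ _ V _ x i (sfun_smooth g) Vx.
rewrite -(pdD df dg).
by apply: (pd_eq_on Vopen) => // y Vy; rewrite svalD.
Qed.

Lemma spdM i f g : spd i (f * g) = spd i f * g + f * spd i g.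
Proof.
apply: sfun_ext => x Vx; rewrite svalD // !svalM // !spdE //.
have df := @smooth_derivable _ _ V _ x i (sfun_smooth f) Vx.
have dg := @smooth_derivable _ _ V _ x i (sfun_smooth g) Vx.
rewrite -(pdM df dg).
by apply: (pd_eq_on Vopen) => // y Vy; rewrite svalM.
Qed.

Lemma spd_comm i j f : spd i (spd j f) = spd j (spd i f).
Proof.
apply: sfun_ext => x Vx; rewrite !(spdE Vx).
have spd_on l y : V y -> spd l f y = pd l f y by move=> Vy; rewrite spdE.
rewrite (pd_eq_on Vopen i (spd_on j) Vx) (pd_eq_on Vopen j (spd_on i) Vx).
exact: (pd_comm Vopen i j (sfun_smooth f) Vx).
Qed.

End SmoothRing.

(** * The geometry of a chart *)

Section CoordinateGeometry.
Variables (A : comPzRingType) (n : nat) (d : 'I_n -> A -> A).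
Variables (Gam : 'I_n -> 'I_n -> 'I_n -> A) (G H : 'M[A]_n).
Local Notation E := 'rV[A]_n.

Definition cder_fun (X : E) (f : A) : A := \sum_i X 0 i * d i f.

Definition cbracket (X Y : E) : E :=
  \row_l (cder_fun X (Y 0 l) - cder_fun Y (X 0 l)).

Definition ccov (X Y : E) : E := \row_l
  (cder_fun X (Y 0 l) + \sum_i \sum_j Gam l i j * X 0 i * Y 0 j).

Definition cip (X Y : E) : A := (X *m G *m Y^T) 0 0.

Hypothesis dD : forall i f h, d i (f + h) = d i f + d i h.
Hypothesis dM : forall i f h, d i (f * h) = d i f * h + f * d i h.
Hypothesis dC : forall i j f, d i (d j f) = d j (d i f).
Hypothesis torsion0 : forall X Y, ccov X Y - ccov Y X = cbracket X Y.
Hypothesis compat : forall X Y Z,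
  cder_fun Z (cip X Y) = cip (ccov Z X) Y + cip X (ccov Z Y).
Hypothesis GT : G^T = G.
Hypothesis GH : G *m H = 1%:M.
Hypothesis HG : H *m G = 1%:M.

Let cderD X f h : cder_fun X (f + h) = cder_fun X f + cder_fun X h.
Proof.
by rewrite /cder_fun -big_split; apply: eq_bigr => i _; rewrite dD mulrDr.
Qed.

Let cderM X f h : cder_fun X (f * h) = cder_fun X f * h + f * cder_fun X h.
Proof.
rewrite /cder_fun mulr_suml mulr_sumr -big_split; apply: eq_bigr => i _.
by rewrite dM /=; ring.
Qed.

Let cder0 X : cder_fun X 0 = 0.
Proof.
have /eqP := cderD X 0 0; rewrite addr0 -subr_eq0 opprD addNKr oppr_eq0.
by move/eqP.
Qed.

Let cderN X f : cder_fun X (- f) = - cder_fun X f.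
Proof. by apply/eqP; rewrite -addr_eq0 -cderD addNr cder0. Qed.

Let cder_sum X (F : 'I_n -> A) : cder_fun X (\sum_i F i) = \sum_i cder_fun X (F i).
Proof. exact: (big_morph (cder_fun X) (cderD X) (cder0 X)). Qed.

Let cder_linear f X Y h :
  cder_fun (f *: X + Y) h = f * cder_fun X h + cder_fun Y h.
Proof.
rewrite /cder_fun mulr_sumr -big_split; apply: eq_bigr => i _.
by rewrite !mxE /=; ring.
Qed.

(** The terms with second partial derivatives are symmetric because the [d i] commute; only
    first-order terms survive. *)
Let cder_bracket X Y f : cder_fun (cbracket X Y) f =
  cder_fun X (cder_fun Y f) - cder_fun Y (cder_fun X f).
Proof.
have expand U W : cder_fun U (cder_fun W f) =
    \sum_i cder_fun U (W 0 i) * d i f + \sum_i \sum_j U 0 i * W 0 j * d i (d j f).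
  rewrite {2}/cder_fun cder_sum [X in _ + X]exchange_big -big_split.
  apply: eq_bigr => i _; rewrite cderM /=; congr (_ + _).
  by rewrite /cder_fun mulr_sumr; apply: eq_bigr => j _; ring.
rewrite !expand [X in _ - (_ + X)]exchange_big /=.
have -> : \sum_i \sum_j Y 0 j * X 0 i * d j (d i f) =
          \sum_i \sum_j X 0 i * Y 0 j * d i (d j f).
  by apply: eq_bigr => i _; apply: eq_bigr => j _; rewrite dC; ring.
rewrite opprD addrACA subrr addr0 -sumrB; apply: eq_bigr => i _.
by rewrite mxE mulrBl.
Qed.

Let ccov_linear f X Y Z : ccov (f *: X + Y) Z = f *: ccov X Z + ccov Y Z.
Proof.
apply/rowP => l; rewrite !mxE cder_linear mulrDr addrACA; congr (_ + _).
rewrite mulr_sumr -big_split; apply: eq_bigr => i _.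
rewrite mulr_sumr -big_split; apply: eq_bigr => j _.
by rewrite !mxE /=; ring.
Qed.

Let ccovD X Y Z : ccov X (Y + Z) = ccov X Y + ccov X Z.
Proof.
apply/rowP => l; rewrite !mxE cderD addrACA; congr (_ + _).
rewrite -big_split; apply: eq_bigr => i _; rewrite -big_split.
by apply: eq_bigr => j _; rewrite !mxE /=; ring.
Qed.

Let ccovM X f Y : ccov X (f *: Y) = cder_fun X f *: Y + f *: ccov X Y.
Proof.
apply/rowP => l; rewrite !mxE cderM -addrA mulrDr; congr (_ + (_ + _)).
rewrite mulr_sumr; apply: eq_bigr => i _; rewrite mulr_sumr.
by apply: eq_bigr => j _; rewrite !mxE; ring.
Qed.

(** By [torsion0] the bracket is the coordinate one, which acts on each component as a commutator of
    derivations. *)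
Let jacobi X Y Z : let br X Y := ccov X Y - ccov Y X in
  br X (br Y Z) + br Y (br Z X) + br Z (br X Y) = 0.
Proof.
rewrite /= !torsion0; apply/rowP => l; rewrite !mxE !cder_bracket.
by rewrite !(cderD, cderN); ring.
Qed.

Let cip_linear f X Y Z : cip (f *: X + Y) Z = f * cip X Z + cip Y Z.
Proof. by rewrite /cip !mulmxDl -!scalemxAl !mxE. Qed.

Let cipC X Y : cip X Y = cip Y X.
Proof.
rewrite /cip -[RHS]trace_mx11 -mxtrace_tr trace_mx11.
by rewrite !trmx_mul trmxK GT mulmxA.
Qed.

Let coframeE i : \sum_k H i k *: (delta_mx 0 k : E) = row i H.
Proof. by rewrite [RHS]row_sum_delta; apply: eq_bigr => k _; rewrite mxE. Qed.

Let cip_delta X j : cip X (delta_mx 0 j) = (X *m G) 0 j.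
Proof.
rewrite /cip trmx_delta; move: (X *m G) => Y.
rewrite mxE (bigD1 j) //= big1 ?addr0 => [|k kj]; rewrite mxE.
  by rewrite !eqxx mulr1.
by rewrite (negPf kj) mulr0.
Qed.

Definition coord_geometry : geometry n.
Proof.
refine (@Geometry n A E cder_fun ccov cip (fun i => delta_mx 0 i) H
  cderD cderM cder_linear ccov_linear ccovD ccovM _ jacobi cip_linear cipC
  compat _ _ _).
- by move=> X Y f; rewrite torsion0.
(* As [G] is symmetric, the transpose of [H] is also an inverse of [G], hence equals [H]. *)
- move=> i j; have := GT; have E1 : H^T *m G = 1%:M.
    by rewrite -{1}GT -trmx_mul GH trmx1.
  have : H^T = H by rewrite -[LHS]mulmx1 -GH mulmxA E1 mul1mx.
  by move=> HT _; rewrite -{1}HT mxE.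
- move=> i j; rewrite coframeE cip_delta -row_mul HG.
  by rewrite mxE mxE.
- move=> X; rewrite -{1}[X]mulmx1 -GH mulmxA mulmx_sum_row.
  by apply: eq_bigr => i _; rewrite cip_delta coframeE.
(* Transparent, because later the projections of this structure are converted to the concrete
   operations. *)
Defined.

End CoordinateGeometry.

(** * Comparison of the concrete tensors in a chart with the algebraic ones *)

Section Transfer.
Context {R : realType} {n : nat} (V : set 'rV[R]_n) (Vopen : open V).
Local Notation S := (smoothfun Vopen).
Local Notation E := 'rV[S]_n.
Implicit Types (x : 'rV[R]_n).

Let row_subE (A : zmodType) m (u v : 'rV[A]_m) l : (u - v) 0 l = u 0 l - v 0 l.
Proof. by rewrite !mxE. Qed.

(** Evaluation as a ring morphism, so that determinants and adjugates commute with it. The proof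
    [Vx] is an argument because the unit of the ring has value 1 only on [V]. *)
Definition value x (Vx : V x) (f : S) : R := f x.

Section Value.
Variables (x : 'rV[R]_n) (Vx : V x).

Let value_zmod : zmod_morphism (value Vx).
Proof. by move=> f g; rewrite /value svalB. Qed.

Let value_monoid : monoid_morphism (value Vx).
Proof. by split=> [|f g]; rewrite /value ?sval1 ?svalM. Qed.

HB.instance Definition _ := GRing.isZmodMorphism.Build S R (value Vx) value_zmod.
HB.instance Definition _ := GRing.isMonoidMorphism.Build S R (value Vx) value_monoid.
End Value.

Definition rep (f : 'rV[R]_n -> R) (h : S) := forall x, V x -> f x = h x.
Definition repv (X : vfield R n) (Y : E) := forall i, rep (fun x => X x 0 i) (Y 0 i).

Lemma rep_smooth f h : rep f h -> smooth_on V f.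
Proof.
move=> fh; apply: (smooth_eq Vopen _ (sfun_smooth h)) => x Vx.
by rewrite fh.
Qed.

Definition vvalue (Y : E) : vfield R n := fun x => \row_i Y 0 i x.

Lemma repv_vvalue Y : repv (vvalue Y) Y.
Proof. by move=> i x Vx; rewrite mxE. Qed.

Lemma repv_smooth X Y : repv X Y -> smooth_field V X.
Proof. by move=> XY i; apply: rep_smooth (XY i). Qed.

Lemma repv_ex X : smooth_field V X -> exists Y, repv X Y.
Proof.
move=> Xs; exists (\row_i restr Vopen (Xs i)) => i x Vx.
by rewrite mxE restrE.
Qed.

Local Notation der_ := (cder_fun (@spd R n V Vopen)).

Lemma dir_rep X Y f h : repv X Y -> rep f h -> rep (dir X f) (der_ Y h).
Proof.
move=> XY fh x Vx; rewrite /dir sval_sum //; apply: eq_bigr => i _.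
by rewrite svalM // spdE // -XY // (pd_eq_on Vopen i fh Vx).
Qed.

Lemma bracket_rep X Y X' Y' : repv X X' -> repv Y Y' ->
  repv (bracket X Y) (cbracket (@spd R n V Vopen) X' Y').
Proof.
move=> XX YY l x Vx; rewrite !mxE svalB //.
by rewrite (dir_rep XX (YY l) Vx) (dir_rep YY (XX l) Vx).
Qed.

Variables (G : 'rV[R]_n -> 'M[R]_n) (Ga : christoffel R n).
Hypothesis G_smooth : forall i j, smooth_on V (fun x => G x i j).
Hypothesis Ga_smooth : forall l i j, smooth_on V (fun x => Ga x l i j).
Hypothesis G_sym : forall x, V x ->
  forall u v, inner (G x) u v = inner (G x) v u.
Hypothesis G_nondeg : forall x, V x ->
  forall u, (forall v, inner (G x) u v = 0) -> u = 0.
Hypothesis Ga_torsion : forall X Y, smooth_field V X -> smooth_field V Y ->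
  forall x, V x -> nabla Ga X Y x - nabla Ga Y X x = bracket X Y x.
Hypothesis G_compat : forall X Y Z,
  smooth_field V X -> smooth_field V Y -> smooth_field V Z ->
  forall x, V x -> dir Z (fun y => inner (G y) (X y) (Y y)) x =
    inner (G x) (nabla Ga Z X x) (Y x) + inner (G x) (X x) (nabla Ga Z Y x).

Definition sgam l i j : S := restr Vopen (Ga_smooth l i j).
Definition sgram : 'M[S]_n := \matrix_(i, j) restr Vopen (G_smooth i j).

Local Notation cov_ := (ccov (@spd R n V Vopen) sgam).
Local Notation ip_ := (cip sgram).

Lemma sgramE x (Vx : V x) : map_mx (value Vx) sgram = G x.
Proof. by apply/matrixP => i j; rewrite !mxE /value restrE. Qed.

Lemma nabla_rep X Y X' Y' : repv X X' -> repv Y Y' ->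
  repv (nabla Ga X Y) (cov_ X' Y').
Proof.
move=> XX YY l x Vx; rewrite !mxE svalD // (dir_rep XX (YY l) Vx).
congr (_ + _); rewrite sval_sum //; apply: eq_bigr => i _.
rewrite sval_sum //; apply: eq_bigr => j _.
by rewrite !svalM // -XX // -YY // restrE.
Qed.

Lemma inner_rep X Y X' Y' : repv X X' -> repv Y Y' ->
  rep (fun x => inner (G x) (X x) (Y x)) (ip_ X' Y').
Proof.
move=> XX YY x Vx; rewrite /inner /cip !mxE sval_sum //; apply: eq_bigr => j _.
rewrite !mxE svalM // -YY //; congr (_ * _).
rewrite sval_sum //; apply: eq_bigr => i _.
by rewrite svalM // -XX // mxE restrE.
Qed.

Lemma scov_torsion X Y : cov_ X Y - cov_ Y X = cbracket (@spd R n V Vopen) X Y.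
Proof.
have XX := repv_vvalue X; have YY := repv_vvalue Y.
apply/rowP => l; apply: sfun_ext => x Vx.
rewrite -(bracket_rep XX YY l Vx) -Ga_torsion //; try exact: repv_smooth.
by rewrite !row_subE svalB // (nabla_rep XX YY l Vx) (nabla_rep YY XX l Vx).
Qed.

Lemma sip_compat X Y Z : der_ Z (ip_ X Y) = ip_ (cov_ Z X) Y + ip_ X (cov_ Z Y).
Proof.
have XX := repv_vvalue X; have YY := repv_vvalue Y; have ZZ := repv_vvalue Z.
apply: sfun_ext => x Vx.
rewrite -(dir_rep ZZ (inner_rep XX YY) Vx) G_compat //; try exact: repv_smooth.
rewrite svalD // -(inner_rep (nabla_rep ZZ XX) YY Vx).
by rewrite -(inner_rep XX (nabla_rep ZZ YY) Vx).
Qed.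

Lemma gram_trmx x : V x -> (G x)^T = G x.
Proof.
move=> Vx; apply/matrixP => i j; rewrite mxE.
have entry k l : inner (G x) (delta_mx 0 k) (delta_mx 0 l) = G x k l.
  by rewrite /inner -rowE trmx_delta -colE !mxE.
by rewrite -!entry G_sym.
Qed.

Lemma gram_det x : V x -> \det (G x) != 0.
Proof.
move=> Vx; apply/negP => /det0P[v v0 vG]; case/eqP: v0.
by apply: (G_nondeg Vx) => w; rewrite /inner vG mul0mx mxE.
Qed.

Let invdet_smooth : smooth_on V (fun x => (\det (G x))^-1).
Proof.
have detE x : V x -> (\det sgram) x = \det (G x).
  by move=> Vx; rewrite -(sgramE Vx) det_map_mx.
apply: (smooth_genP Vopen); apply: sg_inv; first exact: gram_det.
apply: sg_base; apply: (smooth_eq Vopen detE); exact: sfun_smooth.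
Qed.

(** Cramer's rule: among the functions at hand only the determinant has to be inverted, and
    nondegeneracy makes its inverse smooth. *)
Definition scogram : 'M[S]_n := restr Vopen invdet_smooth *: \adj sgram.

Let invdetK : restr Vopen invdet_smooth * \det sgram = 1.
Proof.
apply: sfun_ext => x Vx; rewrite svalM // restrE // sval1 //.
have -> : (\det sgram) x = \det (G x) by rewrite -(sgramE Vx) det_map_mx.
by rewrite mulVf // gram_det.
Qed.

Lemma sgram_cogram : sgram *m scogram = 1%:M.
Proof. by rewrite -scalemxAr mul_mx_adj scale_scalar_mx invdetK. Qed.

Lemma scogram_gram : scogram *m sgram = 1%:M.
Proof. by rewrite -scalemxAl mul_adj_mx scale_scalar_mx invdetK. Qed.

Lemma scogramE x i j : V x -> scogram i j x = invmx (G x) i j.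
Proof.
move=> Vx; rewrite mxE svalM // restrE // /invmx unitmxE unitfE gram_det //.
rewrite [in RHS]mxE; congr (_ * _).
by rewrite -(sgramE Vx) -map_mx_adj [in RHS]mxE.
Qed.

Lemma sgram_trmx : sgram^T = sgram.
Proof.
apply/matrixP => i j; rewrite !mxE; apply: sfun_ext => x Vx.
by rewrite !restrE // -{1}(gram_trmx Vx) mxE.
Qed.

Definition chart_geometry : geometry n :=
  coord_geometry (@spdD R n V Vopen) (@spdM R n V Vopen) (@spd_comm R n V Vopen)
    scov_torsion sip_compat sgram_trmx sgram_cogram scogram_gram.

Local Notation cg := chart_geometry.

Lemma curv_rep X Y Z X' Y' Z' : repv X X' -> repv Y Y' -> repv Z Z' ->
  repv (curv Ga X Y Z) (@curvop n cg X' Y' Z').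
Proof.
move=> XX YY ZZ l x Vx; rewrite /curvop /=  scov_torsion.
have br := bracket_rep XX YY.
rewrite !row_subE !svalB // (nabla_rep XX (nabla_rep YY ZZ) l Vx).
by rewrite (nabla_rep YY (nabla_rep XX ZZ) l Vx) (nabla_rep br ZZ l Vx).
Qed.

(** Both recursions put the new direction in slot 4 and sum over the same slots, so they agree term
    by term; [curv_rep], the base case, uses that the torsion vanishes. *)
Lemma nablaR_rep k (X : 'I_k.+4 -> vfield R n) (Y : 'I_k.+4 -> E) :
  (forall i, repv (X i) (Y i)) -> rep (nablaR G Ga X) (nab cg k Y).
Proof.
elim: k X Y => [|k IHk] X Y XY x Vx.
  exact: (inner_rep (curv_rep (XY _) (XY _) (XY _)) (XY _) Vx).
rewrite -[nab cg k.+1 Y]/(cder (nab cg k) (Y \o @newdir k)) /cder svalB //.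
rewrite [LHS]/=; congr (_ - _).
  by apply: (dir_rep (XY _) _ Vx); apply: IHk => i; exact: XY.
rewrite sval_sum //; apply: eq_bigr => i _; apply: IHk => // j; rewrite /replace /repl.
by case: eqP => _; [exact: nabla_rep | exact: XY].
Qed.

Lemma qmonomial_rep k m (q : qmonomial k m) (X : 'I_m -> vfield R n)
    (Y : 'I_m -> vf cg) : (forall i, repv (X i) (Y i)) ->
  rep (qmonomial_eval G Ga q X) (qmon_eval q Y).
Proof.
elim: q X Y => {m} [a b ak bk|m s q IHq|m q IHq] X Y XY x Vx.
- rewrite -[qmon_eval _ Y]/(nab cg a (fun i => Y (lshift b.+4 i))
     * nab cg b (fun i => Y (rshift a.+4 i))) svalM // [LHS]/=.
  by congr (_ * _); apply: nablaR_rep.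
- exact: IHq.
rewrite -[qmon_eval _ Y]/(\sum_i \sum_j cometric cg i j *
    qmon_eval q (acons (frame cg i) (acons (frame cg j) Y))).
rewrite [LHS]/= /contract sval_sum //; apply: eq_bigr => i _.
rewrite sval_sum //; apply: eq_bigr => j _; rewrite svalM // scogramE //.
have coord l : repv (@coord_field R n l) (delta_mx 0 l).
  by move=> p y Vy; rewrite !mxE; case: (_ && _); rewrite ?sval1 ?sval0.
congr (_ * _); apply: IHq => // l; rewrite /args_cons /acons.
by case: unliftP => [l' _|_]; [case: unliftP => [l'' _|_] |].
Qed.

End Transfer.

(** * Relations modulo quadratic expressions *)

Section Duality.
Variables (K : fieldType) (I : finType).

Definition pairing (c : {ffun I -> K^o}) (phi : I -> K) : K := \sum_i c i * phi i.

(** Among the matrices whose row space lies in [P], one of maximal rank works: adjoining a vector of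
    [P] keeps the row space inside [P], so it cannot raise the rank. *)
Let subspace_matrix m (P : 'rV[K]_m -> Prop) :
  P 0 -> (forall u v, P u -> P v -> P (u + v)) -> (forall a u, P u -> P (a *: u)) ->
  exists M : 'M[K]_m, forall v, P v <-> (v <= M)%MS.
Proof.
move=> P0 PD PZ.
pose ok r := `[< exists M : 'M[K]_m,
  (forall v : 'rV_m, (v <= M)%MS -> P v) /\ \rank M = r >].
have ok0 : exists r, ok r.
  exists 0%N; apply/asboolP; exists 0; split; last exact: mxrank0.
  by move=> v; rewrite submx0 => /eqP ->.
have okm r : ok r -> (r <= m)%N by move=> /asboolP[M [_ <-]]; exact: rank_leq_row.
case: (ex_maxnP ok0 okm) => r /asboolP[M [MP Mr]] rmax.
exists M => v; split=> [Pv|]; last exact: MP.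
have MvP (u : 'rV_m) : (u <= M + v)%MS -> P u.
  case/sub_addsmxP => -[u1 u2] ->; apply: PD; first exact/MP/submxMl.
  by rewrite [u2]mx11_scalar mul_scalar_mx; apply: PZ.
have sM := addsmxSl M v.
have /rmax rle : ok (\rank (M + v)%MS) by apply/asboolP; exists (M + v)%MS.
have := (mxrank_leqif_sup sM).2; rewrite eqn_leq (mxrankS sM) Mr rle => /esym.
exact: submx_trans (addsmxSr M v).
Qed.

(* Replaces computation in the quotient by [P]: it suffices to check [c] against
   the functions annihilating [P]. *)
Lemma duality (P : {ffun I -> K^o} -> Prop) (c : {ffun I -> K^o}) :
  P 0 -> (forall u v, P u -> P v -> P (u + v)) -> (forall a u, P u -> P (a *: u)) ->
  (forall phi, (forall w, P w -> pairing w phi = 0) -> pairing c phi = 0) -> P c.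
Proof.
move=> P0 PD PZ ann.
pose of_row (v : 'rV[K]_#|I|) : {ffun I -> K^o} := [ffun i => v 0 (enum_rank i)].
have of_rowK (w : {ffun I -> K^o}) : of_row (\row_j (w (enum_val j) : K)) = w.
  by apply/ffunP => i; rewrite ffunE mxE enum_rankK.
have [||a u|M MP] := @subspace_matrix _ (fun v => P (of_row v)).
- by rewrite [of_row 0](_ : _ = 0) //; apply/ffunP => i; rewrite !ffunE mxE.
- move=> u v Pu Pv; rewrite [of_row _](_ : _ = of_row u + of_row v); first exact: PD.
  by apply/ffunP => i; rewrite !ffunE mxE.
- move=> Pu; rewrite [of_row _](_ : _ = a *: of_row u); first exact: PZ.
  by apply/ffunP => i; rewrite !ffunE mxE.
(* The columns of [cokermx M] are the functionals to test with: they annihilate [P] and together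
   detect membership in it. *)
have pairE (w : {ffun I -> K^o}) j : (\row_j (w (enum_val j) : K) *m cokermx M) 0 j =
    pairing w (fun i => cokermx M (enum_rank i) j).
  rewrite mxE (reindex (@enum_rank I)) /=; last exact: onW_bij (enum_rank_bij I).
  by apply: eq_bigr => i _; rewrite mxE enum_rankK.
rewrite -[c]of_rowK; apply/MP; rewrite submxE; apply/eqP/rowP => j.
rewrite pairE [RHS]mxE; apply: ann => w; rewrite -{1}[w]of_rowK => /MP.
by rewrite submxE -pairE => /eqP ->; rewrite mxE.
Qed.

End Duality.

(** * Recovering a curvature-like function of letters from its Jacobi sums *)

Section CurvatureWords.
Variables (K : realFieldType) (L : finType) (F : L -> L -> L -> L -> K).
Hypothesis Funiq : forall a b c d, ~~ uniq [:: a; b; c; d] -> F a b c d = 0.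
Hypothesis F12 : forall a b c d, F b a c d = - F a b c d.
Hypothesis F34 : forall a b c d, F a b d c = - F a b c d.
Hypothesis Fb1 : forall a b c d, F a b c d + F b c a d + F c a b d = 0.
Hypothesis Fb2 : forall a b c d e, uniq [:: a; b; c; d; e] ->
  F a b c d + F b e c d + F e a c d = 0.

(** The classical octahedron argument: four instances of the first Bianchi identity combined with
    the antisymmetries. *)
Let Fpair a b c d : F a b c d = F c d a b.
Proof.
have := Fb1 a b c d; have := Fb1 b c d a; have := Fb1 c d a b; have := Fb1 d a b c.
rewrite (F34 a b c d) (F34 b c a d) (F34 c d a b) (F34 a c b d) (F12 c a b d).
by rewrite (F34 d b a c) (F12 b d a c) (F34 d a b c); lra.
Qed.

Let F0_13 a b d : F a b a d = 0.
Proof. by apply: Funiq; rewrite /= !inE eqxx orbT. Qed.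
Let F0_14 a b c : F a b c a = 0.
Proof. by apply: Funiq; rewrite /= !inE eqxx !orbT. Qed.
Let F0_23 a b d : F b a a d = 0.
Proof. by rewrite F12 F0_13 oppr0. Qed.
Let F0_24 a b c : F b a c a = 0.
Proof. by rewrite F12 F0_14 oppr0. Qed.
Let F0_12 a c d : F a a c d = 0.
Proof. by apply: Funiq; rewrite /= !inE eqxx. Qed.
Let F0_34 a b c : F a b c c = 0.
Proof. by apply: Funiq; rewrite /= !inE eqxx !andbF. Qed.

Definition jacobi_sum y z := \sum_p \sum_q F y p q z.

Let sum_const (s : seq L) (x : K) : uniq s ->
  \sum_p (if p \notin s then x else 0) = x * (#|L| - size s)%:R.
Proof.
move=> us; rewrite -big_mkcond sumr_const -(card_uniqP us) /= mulr_natr.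
by congr (_ *+ _); rewrite -(cardC (mem s)) addKn; apply: eq_card.
Qed.

(** For fixed [q], each [p] outside [{q, z}] contributes [- F a b q z] by the second Bianchi
    identity, which gives the factor [#|L| - 2]. The exceptional values [q = a] and [q = b] add one
    further copy by the first Bianchi identity. *)
Let jacobi_sum_diff a b z : uniq [:: a; b; z] -> (3 < #|L|)%N ->
  jacobi_sum b z - jacobi_sum a z = - (#|L|.-1)%:R * \sum_q F a b q z.
Proof.
rewrite /= !inE !negb_or => /andP[/andP[ab az] /andP[bz _]] L3.
(* Corrections are needed only at [q = a] and [q = b], where one term on the left vanishes and the
   other need not. For [p = a] and [p = b] the generic formula is just antisymmetry in the first
   pair. *)
have pointwise p q : F b p q z - F a p q z =
    - (if p \notin [:: q; z] then F a b q z else 0)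
    + (if q == a then F b p a z else 0) - (if q == b then F a p b z else 0).
  rewrite !inE negb_or; have [->|qz] := eqVneq q z.
    by rewrite !F0_34 !(eq_sym z) (negPf az) (negPf bz) if_same; ring.
  have [->|qa] := eqVneq q a.
    by rewrite (negPf ab) !F0_13 if_same; ring.
  have [->|qb] := eqVneq q b.
    by rewrite F0_13 F0_23 if_same; ring.
  have [->|pq] := eqVneq p q; first by rewrite !F0_23 /=; ring.
  have [->|pz] := eqVneq p z; first by rewrite !F0_24 /=; ring.
  have [->|pa] := eqVneq p a; first by rewrite F0_12 F12 /=; ring.
  have [->|pb] := eqVneq p b; first by rewrite F0_12 /=; ring.
  have u5 : uniq [:: a; b; q; z; p].
    rewrite /= !inE !negb_or (eq_sym a q) (eq_sym a p) (eq_sym b q) (eq_sym b p).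
    by rewrite (eq_sym q p) (eq_sym z p) ab az bz qa qb qz pa pb pq pz.
  by have := Fb2 u5; rewrite (F12 a p) /=; lra.
have -> : jacobi_sum b z - jacobi_sum a z =
    \sum_p (\sum_q - (if p \notin [:: q; z] then F a b q z else 0)
             + F b p a z - F a p b z).
  rewrite -sumrB; apply: eq_bigr => p _.
  rewrite -sumrB (eq_bigr _ (fun q _ => pointwise p q)) sumrB big_split /=.
  by rewrite -!big_mkcond /= !big_pred1_eq.
rewrite sumrB big_split /= exchange_big /=.
have -> : \sum_q \sum_p - (if p \notin [:: q; z] then F a b q z else 0) =
    - (#|L| - 2)%:R * \sum_q F a b q z.
  rewrite mulr_sumr; apply: eq_bigr => q _; rewrite sumrN.
  have [->|qz] := eqVneq q z; first by rewrite F0_34 big1 ?mulr0 ?oppr0 // => p; rewrite if_same.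
  by rewrite sum_const /= ?inE ?qz // mulNr mulrC.
rewrite -addrA -sumrB.
have -> : \sum_p (F b p a z - F a p b z) = - \sum_p F a b p z.
  rewrite -sumrN; apply: eq_bigr => p _.
  by rewrite -[RHS]addr0 -(Fb1 a b p z) (F12 a p); ring.
have -> : #|L|.-1 = (#|L| - 2).+1.
  by case: #|L| L3 => [|[|m]] // _; rewrite !subSS subn0.
by rewrite -natr1; ring.
Qed.

Lemma curvature_from_jacobi a b c d : uniq [:: a; b; c; d] ->
  jacobi_sum b d - jacobi_sum a d - jacobi_sum b c + jacobi_sum a c
  = - (#|L|.-1)%:R * (#|L| - 2)%:R * F a b c d.
Proof.
move=> abcd; have L3 : (3 < #|L|)%N.
  by have /card_uniqP := abcd => /= <-; exact: max_card.
have [abd abc] : uniq [:: a; b; d] /\ uniq [:: a; b; c].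
  by move: abcd; rewrite /= !inE !negb_or => /and4P[/and3P[-> -> ->] /andP[-> ->]].
rewrite jacobi_sum_diff //.
have -> : jacobi_sum b c = jacobi_sum a c - (#|L|.-1)%:R * \sum_q F a b q c.
  by rewrite -mulNr -jacobi_sum_diff //; ring.
(* Every [q] outside [{a, b}] contributes [F a b c d]: by the second Bianchi identity for [c], [d],
   [q], moved to the second pair by [Fpair], and by antisymmetry when [q] is [c] or [d]. *)
suff E : \sum_q F a b q d - \sum_q F a b q c = (#|L| - 2)%:R * F a b c d.
  by rewrite -mulrA -E; ring.
have ab : uniq [:: a; b] by move: abc; rewrite /= !inE negb_or => /andP[/andP[-> _] _].
rewrite -sumrB mulrC -(sum_const _ ab); apply: eq_bigr => q _.
rewrite !inE negb_or; have [->|qa] := eqVneq q a; first by rewrite !F0_13 subrr.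
have [->|qb] := eqVneq q b; first by rewrite !F0_23 subrr.
have [->|qc] := eqVneq q c; first by rewrite F0_34 subr0.
have [->|qd] := eqVneq q d; first by rewrite F0_34 F34; ring.
have u5 : uniq [:: c; d; a; b; q].
  rewrite /= !inE !negb_or (eq_sym c q) (eq_sym d q) (eq_sym a q) (eq_sym b q).
  rewrite qa qb qc qd (eq_sym c a) (eq_sym c b) (eq_sym d a) (eq_sym d b).
  move: abcd; rewrite /= !inE !negb_or.
  by case/and4P => /and3P[-> -> ->] /andP[-> ->] ->.
by have := Fb2 u5; rewrite !(Fpair _ _ a b) (F34 a b q d) /=; lra.
Qed.

End CurvatureWords.

Lemma perm_extend N (x0 : 'I_N) (l : seq 'I_N) : uniq l ->
  exists s : 'S_N, forall j : 'I_N, (j < size l)%N -> s j = nth x0 l j.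
Proof.
move=> ul; pose t := l ++ [seq i <- enum 'I_N | i \notin l].
have ut : uniq t.
  rewrite cat_uniq ul filter_uniq ?enum_uniq // andbT /=.
  by apply/hasPn => i; rewrite mem_filter => /andP[].
have st : size t = N.
  rewrite -[RHS](size_enum_ord N); apply/perm_size/uniq_perm => //.
    exact: enum_uniq.
  by move=> i; rewrite mem_cat mem_filter mem_enum andbT; case: (i \in l).
have tI : injective (fun j : 'I_N => nth x0 t j).
  by move=> i j /eqP; rewrite nth_uniq ?st // => /eqP /val_inj.
by exists (perm tI) => j jl; rewrite permE nth_cat jl.
Qed.

(** * Functions on permutations that depend on the four curvature slots only *)

Section Words.
Variables (K : realFieldType) (k : nat) (f : 'S_k.+4 -> K).
Local Notation N := k.+4.
Local Notation o i := (inord i : 'I_N).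
Local Notation tp i j := (tperm (i : 'I_N) (j : 'I_N)).
Hypothesis f01 : forall s : 'S_N, f (tp (o 0) (o 1) * s)%g = - f s.
Hypothesis f23 : forall s : 'S_N, f (tp (o 2) (o 3) * s)%g = - f s.
Hypothesis f012 : forall s : 'S_N,
  f s + f (tp (o 1) (o 2) * (tp (o 0) (o 1) * s))%g
      + f (tp (o 0) (o 1) * (tp (o 1) (o 2) * s))%g = 0.
Hypothesis fswap : forall i, (3 < i)%N -> (i.+1 < N)%N ->
  forall s : 'S_N, f (tp (o i) (o i.+1) * s)%g = f s.

(** In a product the left factor acts first, so left multiplication permutes slots, not letters. *)
Let inv (t : 'S_N) := forall s, f (t * s)%g = f s.

Let inv_mul t u : inv t -> inv u -> inv (t * u)%g.
Proof. by move=> ti ui s; rewrite -mulgA ti ui. Qed.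

(** Induction on the distance: a transposition is a shorter one conjugated by an adjacent one. *)
Let inv_tperm (i j : 'I_N) : (3 < i)%N -> (i < j)%N -> inv (tp i j).
Proof.
move=> i3; have [d] := ubnP (j - i); elim: d j => // d IHd j jd ij.
have [ji|ji] := eqVneq (j : nat) i.+1.
  have jN := ltn_ord j; rewrite ji in jN.
  have -> : j = o i.+1 by apply/val_inj; rewrite /= inordK.
  by rewrite -{1}(inord_val i) => s; exact: fswap.
have jN := ltn_ord j.
pose j' : 'I_N := inord j.-1.
have j'E : (j' : nat) = j.-1 by rewrite /= inordK //; lia.
have ij' : (i < j')%N by rewrite j'E; lia.
have inv1 : inv (tp i j') by apply: IHd => //; rewrite j'E; lia.
have inv2 : inv (tp j' j).
  have -> : j = o j.-1.+1 by rewrite prednK ?inord_val //; lia.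
  by move=> s; apply: fswap; lia.
have -> : tp i j = (tp j' j * (tp i j' * tp j' j))%g.
  have := tpermJ i j' (tp j' j); rewrite tpermL tpermD; first 1 last.
  - by rewrite -val_eqE /=; lia.
  - by rewrite -val_eqE /=; lia.
  by move=> <-; rewrite conjgE tpermV.
by apply: inv_mul => //; apply: inv_mul.
Qed.

(** Induction on the number of moved slots: splitting off the transposition of [x] and [t x] makes
    [x] a fixed slot and moves no new one. *)
Let inv_fix (t : 'S_N) : (forall i : 'I_N, (i < 4)%N -> t i = i) -> inv t.
Proof.
have [d] := ubnP #|[pred x | t x != x]|; elim: d t => // d IHd t td tfix.
have [x tx|t1] := pickP [pred x | t x != x]; last first.
  suff -> : t = 1%g by move=> s; rewrite mul1g.
  by apply/permP => x; rewrite perm1; apply/eqP; have := t1 x; rewrite /= => /negbFE.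
have x4 : (3 < x)%N.
  by rewrite ltnNge; apply/negP => x3; rewrite /= tfix ?eqxx in tx.
have tx4 : (3 < t x)%N.
  rewrite ltnNge; apply/negP => x3; have /perm_inj : t (t x) = t x by rewrite tfix.
  by move=> E; rewrite /= E eqxx in tx.
have -> : t = ((t * tp x (t x)) * tp x (t x))%g by rewrite -mulgA tperm2 mulg1.
apply: inv_mul; last first.
  have [|xx|E] := ltngtP x (t x); first exact: inv_tperm.
    by rewrite tpermC; exact: inv_tperm.
  by rewrite /= -val_eqE /= E eqxx in tx.
apply: IHd => [|i i4]; last first.
  rewrite permM (tfix i) // tpermD //; first by apply: contraTneq x4 => ->; rewrite -leqNgt.
  by apply: contraTneq tx4 => ->; rewrite -leqNgt.
rewrite ltnS in td; apply: leq_trans td; apply: proper_card; apply/properP; split.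
  apply/fintype.subsetP => y; rewrite !inE permM; apply: contraNneq => ty.
  rewrite ty tpermD //; first by apply: contraTneq tx => ->; rewrite /= ty eqxx.
  by apply: contraTneq tx => E; rewrite /= negbK; apply/eqP/(@perm_inj _ t); rewrite E ty.
by exists x => //; rewrite inE permM tpermR eqxx.
Qed.

Let f_eq (s s' : 'S_N) : (forall i, (i < 4)%N -> s (o i) = s' (o i)) -> f s = f s'.
Proof.
move=> ss; have -> : s' = ((s' * s^-1) * s)%g by rewrite mulgKV.
rewrite inv_fix // => i i4.
by rewrite permM -[i]inord_val -ss // permK.
Qed.

Definition is_word (a b c d : 'I_N) (s : 'S_N) :=
  [&& s (o 0) == a, s (o 1) == b, s (o 2) == c & s (o 3) == d].

(* The value of [f] at the permutations starting with a, b, c, d; it is 0 if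
   these letters are not distinct. *)
Definition word a b c d : K :=
  if [pick s | is_word a b c d s] is Some s then f s else 0.

Lemma wordE (s : 'S_N) : f s = word (s (o 0)) (s (o 1)) (s (o 2)) (s (o 3)).
Proof.
rewrite /word; case: pickP => [s' /and4P[/eqP E0 /eqP E1 /eqP E2 /eqP E3]|/(_ s)].
  by apply: f_eq => -[|[|[|[|//]]]] _.
by rewrite /is_word !eqxx.
Qed.

Lemma word_uniq a b c d : ~~ uniq [:: a; b; c; d] -> word a b c d = 0.
Proof.
rewrite /word; case: pickP => // s /and4P[/eqP <- /eqP <- /eqP <- /eqP <-].
rewrite -[[:: s _; _; _; _]]/(map s [:: o 0; o 1; o 2; o 3]) map_inj_uniq; last exact: perm_inj.
by rewrite /= !inE -!val_eqE /= !inordK.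
Qed.

Let word_ex (l : seq 'I_N) : uniq l ->
  exists s : 'S_N, forall i, (i < size l)%N -> (i < N)%N -> s (o i) = nth (o 0) l i.
Proof.
by move=> /(perm_extend (o 0))[s sE]; exists s => i il iN; rewrite sE ?inordK.
Qed.

Let tpE i j l : (i < N)%N -> (j < N)%N -> (l < N)%N ->
  tp (o i) (o j) (o l) = o (if l == i then j else if l == j then i else l).
Proof.
by move=> iN jN lN; rewrite permE /= -!val_eqE /= !inordK //; case: eqP => // _; case: eqP.
Qed.

Let wordP a b c d : (uniq [:: a; b; c; d] /\
    exists s : 'S_N, [/\ s (o 0) = a, s (o 1) = b, s (o 2) = c & s (o 3) = d])
  \/ ~~ uniq [:: a; b; c; d].
Proof.
have [u|] := boolP (uniq [:: a; b; c; d]); last by right.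
left; split=> //; have [s sE] := word_ex u.
by exists s; split; rewrite sE.
Qed.

Lemma word_anti12 a b c d : word b a c d = - word a b c d.
Proof.
have [[_ [s [<- <- <- <-]]]|nu] := wordP a b c d.
  by rewrite -wordE -f01 wordE !permM !tpE.
by rewrite !word_uniq ?oppr0 // (@eq_uniq _ _ [:: a; b; c; d]) // => i;
 rewrite !inE; case: (i == a); case: (i == b).
Qed.

Lemma word_anti34 a b c d : word a b d c = - word a b c d.
Proof.
have [[_ [s [<- <- <- <-]]]|nu] := wordP a b c d.
  by rewrite -wordE -f23 wordE !permM !tpE.
by rewrite !word_uniq ?oppr0 // (@eq_uniq _ _ [:: a; b; c; d]) // => i;
 rewrite !inE; case: (i == c); case: (i == d).
Qed.

Lemma word_bianchi1 a b c d : word a b c d + word b c a d + word c a b d = 0.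
Proof.
have [[_ [s [<- <- <- <-]]]|nu] := wordP a b c d.
  by rewrite -[RHS](f012 s) !wordE !permM !tpE.
by rewrite !word_uniq ?addr0 // (@eq_uniq _ _ [:: a; b; c; d]) // => i;
 rewrite !inE; case: (i == a); case: (i == b); case: (i == c).
Qed.

Hypothesis f01max : (0 < k)%N -> forall s : 'S_N,
  f s + f (tp (o 1) ord_max * (tp (o 0) (o 1) * s))%g
      + f (tp (o 0) (o 1) * (tp (o 1) ord_max * s))%g = 0.

(** Five distinct letters force [k] to be positive. The identity for [f] involves the last slot, so
    a permutation with [e] there is needed. *)
Lemma word_bianchi2 a b c d e : uniq [:: a; b; c; d; e] ->
  word a b c d + word b e c d + word e a c d = 0.
Proof.
move=> u; have k0 : (0 < k)%N.
  have /card_uniqP /= u5 := u.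
  by have := max_card (mem [:: a; b; c; d; e]); rewrite u5 card_ord.
have [s0 s0E] := word_ex u.
have maxE : ord_max = o k.+3 by apply/val_inj; rewrite /= inordK.
(* [s0] has [e] in slot 4; the transposition moves it to the last slot, and is trivial when
   [k = 1]. *)
pose s := (tp (o 4) ord_max * s0)%g.
have sE i : (i < 4)%N -> s (o i) = nth (o 0) [:: a; b; c; d; e] i.
  move=> i4; have iN : (i < N)%N by lia.
  rewrite permM maxE tpE // -s0E //; last by rewrite /=; lia.
  have -> : (i == 4) = false by lia.
  by have -> : (i == k.+3) = false by lia.
have smax : s ord_max = e by rewrite permM tpermR s0E.
move: s sE smax => s sE smax.
have [E0 E1 E2 E3] : [/\ s (o 0) = a, s (o 1) = b, s (o 2) = c & s (o 3) = d].
  by split; rewrite sE.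
have n3 : (3 == k.+3)%N = false by lia.
rewrite -{1}E0 -{1}E1 -E2 -E3 -wordE -[RHS](f01max k0 s) !wordE !permM !maxE !tpE //=.
all: by rewrite ?n3 /= -?maxE ?smax ?E0 ?E1.
Qed.

End Words.

(** By translation in the symmetric group, each ordered pair of distinct values is attained by the
    same number of permutations. *)
Lemma sum_perm_pair (K : realFieldType) m (G : 'I_m.+2 -> 'I_m.+2 -> K) :
  (forall p, G p p = 0) ->
  (\sum_(s : 'S_m.+2) G (s (inord 0)) (s (inord 1))) * (m.+2 * m.+1)%:R
  = (m.+2)`!%:R * \sum_p \sum_q G p q.
Proof.
move=> G0; pose i0 : 'I_m.+2 := inord 0; pose i1 : 'I_m.+2 := inord 1.
have i01 : i0 != i1 by rewrite -val_eqE /= !inordK.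
pose C p q : nat := \sum_(s : 'S_m.+2 | (s i0 == p) && (s i1 == q)) 1.
have C_eq p q : p != q -> C p q = C i0 i1.
  move=> pq; have [|t tE] := @perm_extend _ i0 [:: p; q]; first by rewrite /= inE pq.
  have t0 : t i0 = p by rewrite tE /= inordK.
  have t1 : t i1 = q by rewrite tE /= inordK.
  rewrite /C (reindex_inj (mulIg t)) /=; apply: eq_bigl => s.
  by rewrite !permM -t0 -t1 !(inj_eq perm_inj).
have sum_C (F : 'I_m.+2 -> 'I_m.+2 -> K) : (forall p, F p p = 0) ->
    \sum_(s : 'S_m.+2) F (s i0) (s i1) = (C i0 i1)%:R * \sum_p \sum_q F p q.
  move=> F0; rewrite (partition_big (fun s : 'S_m.+2 => s i0) predT) //= mulr_sumr.
  apply: eq_bigr => p _.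
  rewrite (partition_big (fun s : 'S_m.+2 => s i1) predT) //= mulr_sumr.
  apply: eq_bigr => q _; have [->|pq] := eqVneq p q.
    by rewrite F0 mulr0 big1 // => s /andP[/eqP -> /eqP ->].
  rewrite -(C_eq p q pq) /C natr_sum mulr_suml; apply: eq_bigr => s.
  by move=> /andP[/eqP -> /eqP ->]; rewrite mul1r.
(* Taking the indicator of [p != q] as summand determines that number. *)
have := sum_C (fun p q => (p != q)%:R) _; rewrite {}sum_C // => total.
have {}total : (m.+2)`!%:R = (C i0 i1)%:R * (m.+2 * m.+1)%:R :> K.
  have -> : (m.+2 * m.+1)%:R = \sum_(p : 'I_m.+2) \sum_q (p != q)%:R :> K.
    rewrite natrM mulr_natl -[in X in _ *+ X](card_ord m.+2) -sumr_const.
    apply: eq_bigr => p _; rewrite -natr_sum -big_mkcond sum1_card /=.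
    by rewrite (eq_card (B := predC1 p)) ?cardC1 ?card_ord // => q; rewrite !inE eq_sym.
  have <- := total (fun p => congr1 (fun b => (~~ b)%:R) (eqxx p)).
    rewrite (eq_bigr (fun=> 1)) => [|s _].
      by rewrite sumr_const card_Sn.
    by rewrite (inj_eq perm_inj) i01.
by rewrite total; ring.
Qed.

(** By counting, the image of [A] is the whole complement of [{y, z}]. *)
Lemma sum_off_pair (K : realFieldType) k (y z : 'I_k.+4) (A : 'I_k.+2 -> 'I_k.+4)
    (H : 'I_k.+4 -> K) :
  injective A -> y != z -> (forall i, A i != y) -> (forall i, A i != z) ->
  H y = 0 -> H z = 0 -> \sum_p H p = \sum_i H (A i).
Proof.
move=> AI yz Ay Az Hy Hz.
rewrite (bigID (mem (A @: [set: 'I_k.+2]%SET))) /= addrC big1 ?add0r.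
  rewrite big_imset /=; last by move=> i j _ _; exact: AI.
  by apply: eq_bigl => i; rewrite finset.in_setT.
move=> p pA; suff : p \in [set y; z]%SET by rewrite !inE => /orP[] /eqP ->.
have /eqP <- : ~: (A @: [set: 'I_k.+2]%SET) == [set y; z]%SET; last by rewrite inE.
rewrite eq_sym eqEcard; apply/andP; split.
  apply/fintype.subsetP => q; rewrite !inE => /orP[] /eqP ->.
    by apply/negP => /imsetP[i _ E]; have := Ay i; rewrite E eqxx.
  by apply/negP => /imsetP[i _ E]; have := Az i; rewrite E eqxx.
rewrite cards2 yz cardsCs finset.setCK card_imset // cardsT !card_ord.
by lia.
Qed.

Definition kn_index k (a b : 'I_k.+4) (i : 'I_k.+2) : 'I_k.+4 :=
  match val i with 0 => a | 1 => b | j => inord (j + 2) end.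

(** With [kn_index], the index version of [jacobi_args] and [kn_args]: in the Kulkarni-Nomizu terms
    the arguments are the given fields in permuted order, and this names the permutation. *)
Definition jacobi_index k (A : 'I_k.+2 -> 'I_k.+4) (y z : 'I_k.+4) (i : 'I_k.+4) :
    'I_k.+4 :=
  match val i with
  | 0 => y
  | 1 => A (inord 0)
  | 2 => A (inord 1)
  | 3 => z
  | j => A (inord (j - 2))
  end.

Lemma kn_indexE k (a b : 'I_k.+4) i : (kn_index a b i : nat) =
  if (i == 0 :> nat)%N then a : nat
  else if (i == 1 :> nat)%N then b : nat else (i + 2)%N.
Proof.
by case: i => -[|[|i]] //= ik; rewrite inordK //; lia.
Qed.

Lemma kn_index_inj k (a b : 'I_k.+4) : (a < 4)%N -> (b < 4)%N -> a != b ->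
  injective (kn_index a b).
Proof.
move=> a4 b4; rewrite -val_eqE /= => ab i j /(congr1 val); rewrite /= !kn_indexE => E.
apply/val_inj => /=; move: E.
by do 4?case: ifP; lia.
Qed.

Lemma kn_index_neq k (a b y : 'I_k.+4) i : (y < 4)%N -> a != y -> b != y ->
  kn_index a b i != y.
Proof.
rewrite -!val_eqE /= kn_indexE => y4 ay by_.
by case: ifP => // i0; case: ifP => // i1; lia.
Qed.

Lemma jacobi_indexE k (A : 'I_k.+2 -> 'I_k.+4) y z i : jacobi_index A y z i =
  if (i == 0 :> nat)%N then y else if (i == 3 :> nat)%N then z
  else A (inord (if (i < 3)%N then i.-1 else i - 2)%N).
Proof. by case: i => -[|[|[|[|i]]]]. Qed.

Lemma jacobi_index_inj k (A : 'I_k.+2 -> 'I_k.+4) y z : injective A -> y != z ->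
  (forall i, A i != y) -> (forall i, A i != z) -> injective (jacobi_index A y z).
Proof.
move=> AI yz Ay Az i j; rewrite !jacobi_indexE => E; apply/val_inj => /=; move: E.
have iN := ltn_ord i; have jN := ltn_ord j.
case: (eqVneq (i : nat) 0%N) => i0; case: (eqVneq (j : nat) 0%N) => j0.
- by rewrite i0 j0.
- case: eqVneq => _ E; first by rewrite E eqxx in yz.
  by have := Ay (inord (if (j < 3)%N then j.-1 else j - 2)%N); rewrite -E eqxx.
- case: eqVneq => _ E; first by rewrite E eqxx in yz.
  by have := Ay (inord (if (i < 3)%N then i.-1 else i - 2)%N); rewrite E eqxx.
case: (eqVneq (i : nat) 3%N) => i3; case: (eqVneq (j : nat) 3%N) => j3.
- by rewrite i3 j3.
- by move=> E; have := Az (inord (if (j < 3)%N then j.-1 else j - 2)%N); rewrite -E eqxx.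
- by move=> E; have := Az (inord (if (i < 3)%N then i.-1 else i - 2)%N); rewrite E eqxx.
move=> /AI /(congr1 val); rewrite /= !inordK.
- by case: ifP; case: ifP; lia.
- by case: ifP; lia.
- by case: ifP; lia.
Qed.

Section Pairing.
Variables (K : fieldType) (I : finType) (phi : I -> K).
Implicit Types (u v : {ffun I -> K^o}).

Definition delta_ffun (i : I) : {ffun I -> K^o} := [ffun j => (j == i)%:R].

Lemma pairing0 : pairing 0 phi = 0.
Proof. by rewrite /pairing big1 // => i _; rewrite ffunE mul0r. Qed.

Lemma pairingD u v : pairing (u + v) phi = pairing u phi + pairing v phi.
Proof.
by rewrite /pairing -big_split; apply: eq_bigr => i _; rewrite ffunE mulrDl.
Qed.

Lemma pairingZ a u : pairing (a *: u) phi = a * pairing u phi.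
Proof.
by rewrite /pairing mulr_sumr; apply: eq_bigr => i _; rewrite ffunE mulrA.
Qed.

Lemma pairingN u : pairing (- u) phi = - pairing u phi.
Proof. by rewrite -scaleN1r pairingZ mulN1r. Qed.

Lemma pairing_sum (J : Type) (r : seq J) (F : J -> {ffun I -> K^o}) :
  pairing (\sum_(j <- r) F j) phi = \sum_(j <- r) pairing (F j) phi.
Proof. exact: (big_morph (fun u => pairing u phi) (fun u v => pairingD u v) pairing0). Qed.

Lemma pairing_delta i : pairing (delta_ffun i) phi = phi i.
Proof.
rewrite /pairing (bigD1 i) //= big1 ?addr0 => [|j ji]; rewrite ffunE.
  by rewrite eqxx mul1r.
by rewrite (negPf ji) mul0r.
Qed.

End Pairing.

Section KulkarniNomizu.
Variables (K : realFieldType) (k : nat).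
Local Notation N := k.+4.
Local Notation o i := (inord i : 'I_N).

(** Selected by its values instead of built from an injectivity proof; [jacobi_permE] gives
    conditions under which such a permutation exists. *)
Definition jacobi_perm (a b y z : 'I_N) (s : 'S_k.+2) : 'S_N :=
  odflt 1%g [pick t : 'S_N |
    [forall i, t i == jacobi_index (kn_index a b \o s) y z i]].

Lemma jacobi_permE a b y z s i : uniq [:: a; b; y; z] ->
  all (fun j : 'I_N => (j < 4)%N) [:: a; b; y; z] ->
  jacobi_perm a b y z s i = jacobi_index (kn_index a b \o s) y z i.
Proof.
rewrite /= !inE !negb_or => /and4P[/and3P[ab ay az] /andP[by_ bz] yz _].
case/and5P => a4 b4 y4 z4 _; rewrite /jacobi_perm.
have hI : injective (jacobi_index (kn_index a b \o s) y z).
  apply: jacobi_index_inj => // [|j|j]; try exact: kn_index_neq.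
  by apply: inj_comp perm_inj; exact: kn_index_inj.
case: pickP => [t /forallP/(_ i)/eqP //|/(_ (perm hI))].
by move/negbT/forallPn => [j]; rewrite permE eqxx.
Qed.

(** Not normalized: the factor 1/(k+2)! of the polarization is applied separately. *)
Definition kn_average (phi : 'S_N -> K) (a b y z : 'I_N) : K :=
  \sum_(s : 'S_k.+2) phi (jacobi_perm a b y z s).

(** The polarization puts two letters other than [y] and [z] next to each other in all orders; since
    [F] vanishes at repeated letters, the sum extends to all pairs of letters. *)
Lemma kn_average_word phi (F : 'I_N -> 'I_N -> 'I_N -> 'I_N -> K) a b y z :
  (forall a b c d, ~~ uniq [:: a; b; c; d] -> F a b c d = 0) ->
  (forall s : 'S_N, phi s = F (s (o 0)) (s (o 1)) (s (o 2)) (s (o 3))) ->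
  uniq [:: a; b; y; z] -> all (fun j : 'I_N => (j < 4)%N) [:: a; b; y; z] ->
  kn_average phi a b y z * (k.+2 * k.+1)%:R = (k.+2)`!%:R * jacobi_sum F y z.
Proof.
move=> Fu phiE u a4; pose A := kn_index a b.
have -> : kn_average phi a b y z =
    \sum_(s : 'S_k.+2) F y (A (s (inord 0))) (A (s (inord 1))) z.
  apply: eq_bigr => s _; rewrite phiE !jacobi_permE // /jacobi_index /=.
  by rewrite !inordK.
rewrite (@sum_perm_pair _ _ (fun p q => F y (A p) (A q) z)); last first.
  by move=> p; apply: Fu; rewrite /= !inE eqxx !(andbF, orbT).
congr (_ * _); rewrite /jacobi_sum.
move: u a4; rewrite /= !inE !negb_or => /and4P[/and3P[ab ay az] /andP[by_ bz] yz _].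
case/and5P => a4 b4 y4 z4 _.
have AI : injective A by exact: kn_index_inj.
have Ay i : A i != y by exact: kn_index_neq.
have Az i : A i != z by exact: kn_index_neq.
have F0 p q : (p == y) || (p == z) || (q == y) || (q == z) -> F y p q z = 0.
  move=> pq; apply: Fu; apply: contraL pq; rewrite /= !inE !negb_or.
  case/and4P => /and3P[yp yq _] /andP[_ pz] qz _.
  by rewrite !(eq_sym _ y) yp pz yq qz.
rewrite (@sum_off_pair _ _ y z A) //.
- apply: eq_bigr => p _; rewrite (@sum_off_pair _ _ y z A) //.
    by rewrite F0 // eqxx !orbT.
  by rewrite F0 // eqxx !orbT.
- by rewrite big1 // => q _; rewrite F0 // eqxx.
- by rewrite big1 // => q _; rewrite F0 // eqxx !orbT.
Qed.

(** The left-hand side of the theorem as a formal combination of permutations of the arguments; the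
    identity permutation stands for nabla^k R itself. *)
Definition kn_vector : {ffun 'S_N -> K^o} :=
  let d a b y z := \sum_(s : 'S_k.+2) delta_ffun K (jacobi_perm a b y z s) in
  delta_ffun K 1%g + (k.+1%:R / k.+3%:R * (k.+2`!%:R)^-1) *:
    (d (o 0) (o 2) (o 1) (o 3) - d (o 1) (o 2) (o 0) (o 3)
     - d (o 0) (o 3) (o 1) (o 2) + d (o 1) (o 3) (o 0) (o 2)).

Lemma pairing_kn_vector phi : pairing kn_vector phi =
  phi 1%g + k.+1%:R / k.+3%:R * ((k.+2`!%:R)^-1 *
    (kn_average phi (o 0) (o 2) (o 1) (o 3) - kn_average phi (o 1) (o 2) (o 0) (o 3)
     - kn_average phi (o 0) (o 3) (o 1) (o 2) + kn_average phi (o 1) (o 3) (o 0) (o 2))).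
Proof.
rewrite /kn_vector !(pairingD, pairingZ, pairingN, pairing_sum) pairing_delta.
congr (_ + _); rewrite -[LHS]mulrA; congr (_ * (_ * (_ - _ - _ + _)));
  by apply: eq_bigr => s _; rewrite pairing_delta.
Qed.

Variable phi : 'S_N -> K.
Local Notation tp i j := (tperm (i : 'I_N) (j : 'I_N)).
Hypothesis f01 : forall s : 'S_N, phi (tp (o 0) (o 1) * s)%g = - phi s.
Hypothesis f23 : forall s : 'S_N, phi (tp (o 2) (o 3) * s)%g = - phi s.
Hypothesis f012 : forall s : 'S_N,
  phi s + phi (tp (o 1) (o 2) * (tp (o 0) (o 1) * s))%g
      + phi (tp (o 0) (o 1) * (tp (o 1) (o 2) * s))%g = 0.
Hypothesis f01max : (0 < k)%N -> forall s : 'S_N,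
  phi s + phi (tp (o 1) ord_max * (tp (o 0) (o 1) * s))%g
      + phi (tp (o 0) (o 1) * (tp (o 1) ord_max * s))%g = 0.
Hypothesis fswap : forall i, (3 < i)%N -> (i.+1 < N)%N ->
  forall s : 'S_N, phi (tp (o i) (o i.+1) * s)%g = phi s.

Lemma pairing_kn_vector_eq0 : pairing kn_vector phi = 0.
Proof.
pose F := word phi; have Fu := @word_uniq _ _ phi.
have phiE := wordE fswap.
rewrite pairing_kn_vector.
have u4 (a b c d : nat) : uniq [:: a; b; c; d] -> all (fun i => i < 4)%N [:: a; b; c; d] ->
    uniq [:: o a; o b; o c; o d] /\
    all (fun j : 'I_N => (j < 4)%N) [:: o a; o b; o c; o d].
  move=> u l; split.
    rewrite -[X in uniq X]/(map (fun i => o i) [:: a; b; c; d]) map_inj_in_uniq //.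
    move=> i j /(allP l) i4 /(allP l) j4 /(congr1 val); rewrite /= !inordK //; lia.
  move: l; rewrite /= => /and5P[? ? ? ? _]; rewrite !inordK; lia.
have avg (a b c d : nat) : uniq [:: a; b; c; d] -> all (fun i => i < 4)%N [:: a; b; c; d] ->
    kn_average phi (o a) (o b) (o c) (o d) =
    k.+2`!%:R * jacobi_sum F (o c) (o d) / (k.+2 * k.+1)%:R.
  move=> u l; have [u' l'] := u4 _ _ _ _ u l.
  by rewrite -(kn_average_word Fu phiE u' l') mulfK ?pnatr_eq0.
rewrite !avg // phiE !perm1.
have [u' _] := u4 0%N 1%N 2%N 3%N isT isT.
have := curvature_from_jacobi Fu (word_anti12 f01 fswap) (word_anti34 f23 fswap)
  (word_bianchi1 f012 fswap) (word_bianchi2 fswap f01max) u'.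
rewrite card_ord /=; have -> : (k.+4 - 2 = k.+2)%N by [].
rewrite -/F natrM.
move: (jacobi_sum F _ _) (jacobi_sum F _ _) (jacobi_sum F _ _) (jacobi_sum F _ _) => r4 r3 r2 r1.
have : k.+1%:R != 0 :> K by rewrite pnatr_eq0.
have : k.+2%:R != 0 :> K by rewrite pnatr_eq0.
have : k.+3%:R != 0 :> K by rewrite pnatr_eq0.
have : k.+2`!%:R != 0 :> K by rewrite pnatr_eq0 -lt0n fact_gt0.
move: k.+1%:R k.+2%:R k.+3%:R k.+2`!%:R => a b c e e0 c0 b0 a0 jac.
(* Here [a], [b], [c], [e] are k+1, k+2, k+3, (k+2)!. By [jac] the bracket is [- c * b] times the
   value of the word, so the coefficient [a / c] turns the second summand into minus the first. *)
have -> : e^-1 * (e * r1 / (b * a) - e * r2 / (b * a) - e * r3 / (b * a) + e * r4 / (b * a))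
    = (r1 - r2 - r3 + r4) / (b * a) by field; rewrite a0 b0 e0.
by rewrite jac; field; rewrite a0 b0 c0.
Qed.

End KulkarniNomizu.

(** * Quadratic combinations on the given manifold, and the conclusion *)

Section Null.
Variables (R : realType) (n : nat) (M : manifold R n) (g : metric M)
  (D : connection M).
Hypothesis hD : levi_civita g D.
Variable k : nat.
Local Notation N := k.+4.

(** The subspace for [duality]. The expression is chosen before chart, fields and point, as in the
    theorem. *)
Definition null_comb (c : {ffun 'S_N -> R^o}) : Prop :=
  exists B : qexpr R k, forall a : chart R n M, atlas a ->
    forall X : 'I_N -> vfield R n, (forall i, smooth_field (cimg a) (X i)) ->
    forall x, cimg a x ->
      pairing c (fun s : 'S_N => nablaR (g a) (D a) (X \o s) x)
      = qexpr_eval (g a) (D a) B X x.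

Lemma null_comb0 : null_comb 0.
Proof.
by exists [::] => a aM X Xs x Vx; rewrite pairing0 /qexpr_eval big_nil.
Qed.

Lemma null_combD u v : null_comb u -> null_comb v -> null_comb (u + v).
Proof.
move=> [B BE] [C CE]; exists (B ++ C) => a aM X Xs x Vx.
by rewrite pairingD BE // CE // /qexpr_eval big_cat.
Qed.

Lemma null_combZ (r : R) u : null_comb u -> null_comb (r *: u).
Proof.
move=> [B BE]; exists [seq (r * c.1, c.2) | c <- B] => a aM X Xs x Vx.
rewrite pairingZ BE // /qexpr_eval big_map mulr_sumr.
by apply: eq_bigr => c _; rewrite mulrA.
Qed.

(** Each chart is an instance of [geometry], and the list of monomials does not depend on the
    instance, so one list serves all charts. *)
Lemma quad_null_comb (l : seq (int * 'S_N)) :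
  quad k (fun (h : geometry n) Y => \sum_(c <- l) nab h k (Y \o c.2) *~ c.1) ->
  null_comb (\sum_(c <- l) (c.1)%:~R *: delta_ffun R c.2).
Proof.
move=> ql; have idB : bijective (id : 'I_N -> 'I_N) by exists id.
have [B BE] := quad_qmonomials ql idB.
exists [seq ((c.1)%:~R, c.2) | c <- B] => a aM X Xs x Vx.
have Vo : open (cimg a) := cimg_open (c := a).
have [Y XY] := fin_all_exists (fun i => repv_ex Vo (Xs i)).
have Gs i j := @gram_smooth _ _ _ g a aM i j.
have Gas l0 i j := @gamma_smooth _ _ _ D a aM l0 i j.
pose cg := chart_geometry Vo Gs Gas (@gram_sym _ _ _ g a aM) (@gram_nondeg _ _ _ g a aM)
  (hD.1 a aM) (hD.2 a aM).
have := BE cg Y; rewrite -[Y \o id]/Y => {}BE.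
rewrite pairing_sum /qexpr_eval big_map.
transitivity ((\sum_(c <- l) nab cg k (Y \o c.2) *~ c.1 : smoothfun Vo) x).
  rewrite sval_sum //; apply: eq_bigr => c _; rewrite pairingZ pairing_delta.
  rewrite sval_mulz // mulrC; congr (_ * _).
  have /(_ x Vx) -> // : rep (nablaR (g a) (D a) (X \o c.2)) (nab cg k (Y \o c.2)).
  by apply: nablaR_rep => i; exact: XY.
rewrite BE sval_sum //; apply: eq_bigr => c _ /=.
rewrite sval_mulz // mulrC; congr (_ * _).
have /(_ x Vx) -> // : rep (qmonomial_eval (g a) (D a) c.2 X) (@qmon_eval _ _ _ c.2 cg Y).
exact: qmonomial_rep.
Qed.

Variable phi : 'S_N -> R.
Hypothesis phi_null : forall w, null_comb w -> pairing w phi = 0.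

(** A quadratic relation remains quadratic when its arguments are permuted, so [phi] also kills all
    its translates by [s]. *)
Lemma quad_annihilated (l : seq (int * 'S_N)) s :
  quad k (fun (h : geometry n) Y => \sum_(c <- l) nab h k (Y \o c.2) *~ c.1) ->
  \sum_(c <- l) phi (c.2 * s)%g *~ c.1 = 0.
Proof.
move=> ql; have sB : bijective s by exists (s^-1)%g; [exact: permK | exact: permKV].
pose l' := [seq (c.1, (c.2 * s)%g) | c <- l].
have /quad_null_comb/phi_null : quad k (fun (h : geometry n) Y =>
    \sum_(c <- l') nab h k (Y \o c.2) *~ c.1).
  apply: quad_ext (quad_bij sB ql) => h Y; rewrite big_map; apply: eq_bigr => c _ /=.
  by congr (nab _ _ _ *~ _); apply/funext => i; rewrite /= permM.
rewrite pairing_sum big_map => H; rewrite -[RHS]H; apply: eq_bigr => c _.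
by rewrite pairingZ pairing_delta mulrzl.
Qed.

Local Notation o i := (inord i : 'I_N).
Local Notation tp i j := (tperm (i : 'I_N) (j : 'I_N)).

Let seqE (F : int * 'S_N -> R) c1 c2 : \sum_(c <- [:: c1; c2]) F c = F c1 + F c2.
Proof. by rewrite big_cons big_seq1. Qed.

(** An exact symmetry is a relation whose quadratic right-hand side is 0. *)
Let annihilated_anti a b s : (forall h : geometry n, anti (nab h k) a b) ->
  phi (tp a b * s)%g = - phi s.
Proof.
move=> nab_ab; have := @quad_annihilated [:: (1, tp a b); (1, 1%g)] s.
rewrite seqE /= mul1g => H; apply/eqP; rewrite -addr_eq0; apply/eqP/H.
apply: quad_ext (quad0 n k _) => h Y; rewrite big_cons big_seq1 /= nab_ab.
have -> : Y \o (1%g : 'S_N) = Y by apply/funext => i; rewrite /= perm1.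
by rewrite addNr.
Qed.

Let annihilated_cyc3 a b c s : (forall h : geometry n, cyc3 (nab h k) a b c) ->
  phi s + phi (tp b c * (tp a b * s))%g + phi (tp a b * (tp b c * s))%g = 0.
Proof.
move=> nab_abc.
have := @quad_annihilated [:: (1, 1%g); (1, (tp b c * tp a b)%g); (1, (tp a b * tp b c)%g)] s.
rewrite !big_cons big_nil /= mul1g addr0 addrA !mulgA; apply.
apply: quad_ext (quad0 n k _) => h Y; rewrite !big_cons big_nil /= addr0 addrA.
rewrite -[LHS](nab_abc h Y) !mulr1z; congr (_ + _ + _); congr nab;
  by apply/funext => i; rewrite /= ?perm1 ?permM.
Qed.

Lemma annihilated_kn_vector : pairing (kn_vector R k) phi = 0.
Proof.
apply: pairing_kn_vector_eq0.
- by move=> s; apply: annihilated_anti => h; exact: nab_anti01.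
- by move=> s; apply: annihilated_anti => h; exact: nab_anti23.
- by move=> s; apply: annihilated_cyc3 => h; exact: nab_cyc012.
- move=> k0 s; apply: annihilated_cyc3 => h.
  by case: k k0 => // j _; exact: nab_cyc01max.
- move=> i i3 iN s.
  have := @quad_annihilated [:: (1, tp (o i) (o i.+1)); (-1, 1%g)] s.
  rewrite seqE /= mul1g mulrNz mulr1z => H; apply/eqP; rewrite -subr_eq0.
  apply/eqP/H; apply: quad_ext (quad_swap n i3 iN) => h Y.
  rewrite big_cons big_seq1 /= mulrNz mulr1z; congr (_ - nab _ _ _).
  by apply/funext => l; rewrite /= perm1.
Qed.

End Null.

Lemma jacobi_args_comp (R : realType) n k (X : 'I_k.+4 -> vfield R n) a b y z
    (s : 'S_k.+2) : uniq [:: a; b; y; z] ->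
  all (fun j : 'I_k.+4 => (j < 4)%N) [:: a; b; y; z] ->
  jacobi_args (fun i => kn_args (X a) (X b) X (s i)) (X y) (X z)
  = X \o jacobi_perm a b y z s.
Proof.
move=> u l; apply/funext => i; rewrite /= jacobi_permE //.
have knE j : kn_args (X a) (X b) X j = X (kn_index a b j).
  by case: j => -[|[|j]].
by case: i => -[|[|[|[|i]]]] ? //; rewrite /jacobi_args /= knE.
Qed.

Lemma KN_symcurv (R : realType) n (G : 'rV[R]_n -> 'M[R]_n) Ga k
    (X : 'I_k.+4 -> vfield R n) x :
  let avg a b y z := kn_average (fun s : 'S_k.+4 => nablaR G Ga (X \o s) x)
    (inord a) (inord b) (inord y) (inord z) in
  KN (symcurv G Ga (k := k)) X x = (k.+2`!%:R)^-1 *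
    (avg 0%N 2%N 1%N 3%N - avg 1%N 2%N 0%N 3%N - avg 0%N 3%N 1%N 2%N
     + avg 1%N 3%N 0%N 2%N).
Proof.
move=> avg; rewrite /KN /symcurv !(mulrDr, mulrBr).
have E (a b y z : nat) : uniq [:: a; b; y; z] -> all (fun i => i < 4)%N [:: a; b; y; z] ->
  \sum_(s : 'S_k.+2) nablaR G Ga (jacobi_args (fun i =>
     kn_args (X (inord a)) (X (inord b)) X (s i)) (X (inord y)) (X (inord z))) x
  = avg a b y z.
  move=> u l; apply: eq_bigr => s _; rewrite jacobi_args_comp //.
    rewrite -[X in uniq X]/(map (fun i => inord i : 'I_k.+4) [:: a; b; y; z]).
    rewrite map_inj_in_uniq // => i j /(allP l) i4 /(allP l) j4 /(congr1 val).
    by rewrite /= !inordK //; lia.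
  by move: l; rewrite /= => /and5P[? ? ? ? _]; rewrite !inordK; lia.
by rewrite !E //; ring.
Qed.

Theorem corollary2 (R : realType) (n : nat) (M : manifold R n) (g : metric M)
    (D : connection M) (hD : levi_civita g D) (k : nat) :
  exists B : qexpr R k,
    forall a : chart R n M, atlas a ->
    forall X : 'I_k.+4 -> vfield R n,
      (forall i, smooth_field (cimg a) (X i)) ->
    forall x : 'rV[R]_n, cimg a x ->
      nablaR (g a) (D a) X x
      + (k.+1)%:R / (k.+3)%:R * KN (symcurv (g a) (D a) (k := k)) X x
      = qexpr_eval (g a) (D a) B X x.
Proof.
have [B BE] : null_comb g D (kn_vector R k).
  apply: duality; [exact: null_comb0 | exact: null_combD | exact: null_combZ |].
  by move=> phi; exact: annihilated_kn_vector.
exists B => a aM X Xs x Vx; rewrite -BE // pairing_kn_vector KN_symcurv.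
by have -> : X \o (1%g : 'S_k.+4) = X by apply/funext => i; rewrite /= perm1.
Qed.
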